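(* Let $(\ell,m)\in\mathcal{I}$, $0<\eta\le1$ and $P\in\mathbb{N}$, $P\geq 1$, be given. For any propagative plane wave approximation set $\Phi_P=\{P^{-1/2}\,\mathrm{PW}_{\boldsymbol{\theta}_p}\}_{p=1}^P$ with $\{\boldsymbol{\theta}_p\}_{p=1}^P\subset\Theta$, with synthesis operator $\mathrm{T}_P\boldsymbol{\mu}=P^{-1/2}\sum_{p=1}^P\mu_p\,\mathrm{PW}_{\boldsymbol{\theta}_p}$, and for every coefficient vector $\boldsymbol{\mu}\in\mathbb{C}^P$, $$\text{if}\quad\|b_\ell^m-\mathrm{T}_P\boldsymbol{\mu}\|_{\mathcal{B}}\le\eta\|b_\ell^m\|_{\mathcal{B}}\quad\text{then}\quad\|\boldsymbol{\mu}\|_{\ell^2}\ge(1-\eta)\frac{\beta_\ell}{2\sqrt{\pi(2\ell+1)}}\|b_\ell^m\|_{\mathcal{B}}.$$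
   Context: Fix a real wavenumber $\kappa>0$; $B_1$ is the open unit ball and $\mathbb{S}^2$ the unit sphere of $\mathbb{R}^3$; $\mathcal{I}=\{(\ell,m)\in\mathbb{Z}^2:0\le|m|\le\ell\}$. Let $\Theta=[0,\pi]\times[0,2\pi)$. For $\boldsymbol{\theta}=(\theta_1,\theta_2)\in\Theta$, $\mathbf{d}(\boldsymbol{\theta})=(\sin\theta_1\cos\theta_2,\sin\theta_1\sin\theta_2,\cos\theta_1)\in\mathbb{S}^2$ and $\mathrm{PW}_{\boldsymbol{\theta}}(\mathbf{x})=e^{i\kappa\,\mathbf{d}(\boldsymbol{\theta})\cdot\mathbf{x}}$. For $u\in H^1(B_1)$, $\|u\|_{\mathcal{B}}^2=\|u\|_{L^2(B_1)}^2+\kappa^{-2}\|\nabla u\|_{L^2(B_1)^3}^2$. The spherical waves are $\tilde b_\ell^m(\mathbf{x})=j_\ell(\kappa|\mathbf{x}|)Y_\ell^m(\mathbf{x}/|\mathbf{x}|)$ on $B_1$, where $j_\ell(r)=\sqrt{\pi/2r}\,J_{\ell+1/2}(r)$ is the spherical Bessel function and $Y_\ell^m$ are the $L^2(\mathbb{S}^2)$-orthonormal spherical harmonics $Y_\ell^m(\theta,\varphi)=\gamma_\ell^me^{im\varphi}\mathsf{P}_\ell^m(\cos\theta)$, $\gamma_\ell^m=\left[\frac{2\ell+1}{4\pi}\frac{(\ell-m)!}{(\ell+m)!}\right]^{1/2}$, with $\mathsf{P}_\ell^m(x)=\frac{(-1)^m}{2^\ell\ell!}(1-x^2)^{m/2}\frac{d^{\ell+m}}{dx^{\ell+m}}(x^2-1)^\ell$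 for $m\ge0$ and $\mathsf{P}_\ell^{-m}=(-1)^m\frac{(\ell-m)!}{(\ell+m)!}\mathsf{P}_\ell^m$. Then $\beta_\ell=\|\tilde b_\ell^m\|_{\mathcal{B}}^{-1}$ (independent of $m$) and $b_\ell^m=\beta_\ell\tilde b_\ell^m$. *)

(* Defs.v *)
From HB Require Import structures.
From mathcomp Require Import all_boot all_order all_algebra.
From mathcomp Require Import all_classical all_reals all_analysis.
From mathcomp Require Import complex.

Set Implicit Arguments.
Unset Strict Implicit.
Unset Printing Implicit Defensive.

Import Order.TTheory GRing.Theory Num.Theory.
Import numFieldNormedType.Exports.

Local Open Scope classical_set_scope.
Local Open Scope ring_scope.
Local Open Scope complex_scope.

Section Geometry.
Context {R : realType}.

(* Points of R^3 are triples ((x1, x2), x3). *)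
Definition vdot (x y : R * R * R) : R :=
  x.1.1 * y.1.1 + x.1.2 * y.1.2 + x.2 * y.2.

Definition vnorm (x : R * R * R) : R := Num.sqrt (vdot x x).

Definition vscale (a : R) (x : R * R * R) : R * R * R :=
  (a * x.1.1, a * x.1.2, a * x.2).

Definition unit_ball : set (R * R * R) := [set x | vnorm x < 1].

Definition lebesgue_measure3 :=
  ((@lebesgue_measure R \x @lebesgue_measure R) \x @lebesgue_measure R)%E.

Definition Theta : set (R * R) :=
  [set t | 0 <= t.1 <= pi /\ 0 <= t.2 < 2 * pi].

Definition direction (t : R * R) : R * R * R :=
  (sin t.1 * cos t.2, sin t.1 * sin t.2, cos t.1).

(* Spherical angles of a point of the unit sphere. They are unique except at
   the two poles, where the second angle is an arbitrary element of [0, 2 pi);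
   spherical harmonics do not depend on it there. *)
Definition angles (x : R * R * R) : R * R :=
  xget (0, 0) [set t | Theta t /\ direction t = x].

End Geometry.

Section Norms.
Context {R : realType}.

Definition cis (t : R) : R[i] := cos t +i* sin t.

Definition sqnormc (z : R[i]) : R := complex.Re z ^+ 2 + complex.Im z ^+ 2.

(* Squared Euclidean norm of the gradient of a real function. *)
Definition sqgrad (f : R * R * R -> R) (x : R * R * R) : R :=
  (derive1 (fun t => f (t, x.1.2, x.2)) x.1.1) ^+ 2 +
  (derive1 (fun t => f (x.1.1, t, x.2)) x.1.2) ^+ 2 +
  (derive1 (fun t => f (x.1.1, x.1.2, t)) x.2) ^+ 2.

Definition sqnormL2 (u : R * R * R -> R[i]) : R :=
  \int[lebesgue_measure3]_(x in unit_ball) sqnormc (u x).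

(* The gradient is taken pointwise. For a function which, like the plane waves
   and the spherical waves, coincides away from the origin with one that is
   smooth on a neighbourhood of the closed ball, this is the weak gradient of
   the theory of H^1, up to a null set. *)
Definition sqnormL2_grad (u : R * R * R -> R[i]) : R :=
  \int[lebesgue_measure3]_(x in unit_ball)
    (sqgrad (fun y => complex.Re (u y)) x + sqgrad (fun y => complex.Im (u y)) x).

Definition normB (kappa : R) (u : R * R * R -> R[i]) : R :=
  Num.sqrt (sqnormL2 u + kappa ^- 2 * sqnormL2_grad u).

Definition norm_l2 (P : nat) (mu : 'I_P -> R[i]) : R :=
  Num.sqrt (\sum_(p < P) sqnormc (mu p)).

End Norms.

Section SpecialFunctions.
Context {R : realType}.

Definition Gamma (s : R) : R :=
  \int[lebesgue_measure]_(t in `]0, +oo[) (t `^ (s - 1) * expR (- t)).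

(* Bessel function of the first kind, for a positive argument. *)
Definition besselJ (nu x : R) : R :=
  limn (series (fun k : nat =>
    (-1) ^+ k / (k`!%:R * Gamma (k%:R + nu + 1)) * (x / 2) `^ (k%:R *+ 2 + nu))).

(* The value at r = 0 is the junk value 0; it only affects the spherical waves
   at the origin. *)
Definition spherical_bessel (l : nat) (r : R) : R :=
  Num.sqrt (pi / (2 * r)) * besselJ (l%:R + 2^-1) r.

Definition legendre_nat (l m : nat) (x : R) : R :=
  (-1) ^+ m / (2 ^+ l * l`!%:R) * (1 - x ^+ 2) `^ (m%:R / 2)
  * ((('X ^+ 2 - 1) ^+ l : {poly R})^`(l + m)).[x].

Definition legendre (l : nat) (m : int) (x : R) : R :=
  match m with
  | Posz n => legendre_nat l n x
  | Negz n' => let n := n'.+1 in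
      (-1) ^+ n * ((l - n)`!%:R / (l + n)`!%:R) * legendre_nat l n x
  end.

Definition harmonic_coef (l : nat) (m : int) : R :=
  Num.sqrt ((2 * l%:R + 1) / (4 * pi)
            * ((absz (l%:Z - m))`!%:R / (absz (l%:Z + m))`!%:R)).

Definition spherical_harmonic (l : nat) (m : int) (t : R * R) : R[i] :=
  (harmonic_coef l m)%:C * cis (m%:~R * t.2) * (legendre l m (cos t.1))%:C.

End SpecialFunctions.

Section Waves.
Context {R : realType} (kappa : R).

Definition plane_wave (t : R * R) (x : R * R * R) : R[i] :=
  cis (kappa * vdot (direction t) x).

Definition spherical_wave_tilde (l : nat) (m : int) (x : R * R * R) : R[i] :=
  (spherical_bessel l (kappa * vnorm x))%:C
  * spherical_harmonic l m (angles (vscale (vnorm x)^-1 x)).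

(* The value does not depend on m, for |m| <= l. *)
Definition beta (l : nat) (m : int) : R :=
  (normB kappa (spherical_wave_tilde l m))^-1.

Definition spherical_wave (l : nat) (m : int) (x : R * R * R) : R[i] :=
  (beta l m)%:C * spherical_wave_tilde l m x.

Definition synthesis (P : nat) (theta : 'I_P -> R * R) (mu : 'I_P -> R[i])
    (x : R * R * R) : R[i] :=
  ((Num.sqrt P%:R)^-1)%:C * \sum_(p < P) mu p * plane_wave (theta p) x.

End Waves.

(* Main.v *)
(* Let V be the squared norm of the unnormalised spherical wave b~. The pairing of a plane wave of
   direction d with b~ is, up to a phase, 4 pi Y(d) V by the Funk-Hecke formula, and |Y(d)| <=
   sqrt((2l+1)/(4 pi)). Pairing the residual b - T mu with b~ and applying Cauchy-Schwarz gives
   beta V - |mu| sqrt(4 pi (2l+1)) V <= sqrt V |b - T mu|, which is the claim since beta sqrt V = 1.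

   These pairings are computed exactly for truncated series, by formal calculus on polynomials in
   three variables: divergence theorem with weight 1 - |x|^2, sphere integrals defined through ball
   integrals, and Green's identity, which gives the moments M_n of (d.x)^n against a harmonic
   polynomial of degree l the recursion (n-l)(n+l+1) M_n = n(n-1) M_{n-2}. The same factor
   then appears in the pairing and in V at each order of truncation, and dominated convergence
   passes to the limit. *)

Require Import Defs.
From HB Require Import structures.
From mathcomp Require Import all_boot all_order all_algebra.
From mathcomp Require Import all_classical all_reals all_analysis.
From mathcomp Require Import measurable_realfun complex zify ring lra.

Set Implicit Arguments.
Unset Strict Implicit.
Unset Printing Implicit Defensive.

Import Order.TTheory GRing.Theory Num.Theory.
Local Open Scope ring_scope.

(** * Legendre polynomials *)

(** The calculus lives in a commutative ring with three commuting derivations and a functional [I],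
    in which the only trace of integration, besides linearity and positivity, is [I_parts]. Since
    the weight 1 - |x|^2 vanishes on the sphere, no surface measure has to be constructed.

    The surface area drops out as well: sphere integrals matter only relative to [sg 1], and
    orthonormality of the spherical harmonics enters as 4 pi sg(|Y|^2) = sg 1. The bound on Y(d) is
    a Cauchy-Schwarz inequality against the zonal harmonic of pole d, which takes the place of the
    addition theorem. Complex functions are pairs of real polynomials, and only the real part of
    each pairing is used. The radial factor, whose value would involve integrals of Bessel
    functions, is never evaluated. *)

Section Legendre.
Variable R : realFieldType.
Implicit Types p q : {poly R}.

(* Half the integral over [-1, 1]. *)
Definition lam p : R := \sum_(i < size p) (if odd i then 0 else i.+1%:R^-1) * p`_i.

Lemma lam_wide n p : (size p <= n)%N ->
  lam p = \sum_(i < n) (if odd i then 0 else i.+1%:R^-1) * p`_i.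
Proof.
move=> pn; rewrite /lam (big_ord_widen n (fun i => (if odd i then 0 else i.+1%:R^-1) * p`_i))//.
rewrite big_mkcond; apply: eq_bigr => i _; case: ltnP => // h.
by rewrite nth_default// mulr0.
Qed.

Lemma lamD p q : lam (p + q) = lam p + lam q.
Proof.
pose n := maxn (size p) (size q).
rewrite !(@lam_wide n) ?leq_maxl ?leq_maxr ?size_polyD// -big_split.
by apply: eq_bigr => i _ /=; rewrite coefD mulrDr.
Qed.

Lemma lamZ c p : lam (c *: p) = c * lam p.
Proof.
rewrite (@lam_wide (size p)) ?size_scale_leq// mulr_sumr.
by apply: eq_bigr => i _ /=; rewrite coefZ mulrCA.
Qed.

Lemma lamXn n : lam 'X^n = if odd n then 0 else n.+1%:R^-1.
Proof.
rewrite (@lam_wide n.+1) ?size_polyXn// (bigD1 ord_max)//= coefXn eqxx mulr1.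
rewrite big1 ?addr0// => i; rewrite -val_eqE/= => /negbTE ni.
by rewrite coefXn ni mulr0.
Qed.

Lemma lam0 : lam 0 = 0.
Proof. by have := lamZ 0 0; rewrite scaler0 mul0r. Qed.

Lemma lam_sum (J : Type) (s : seq J) (P : pred J) (F : J -> {poly R}) :
  lam (\sum_(j <- s | P j) F j) = \sum_(j <- s | P j) lam (F j).
Proof. by elim/big_rec2: _ => [|j x y _ <-]; rewrite ?lam0 ?lamD. Qed.

Lemma lam_deriv p : 2 * lam p^`() = p.[1] - p.[-1].
Proof.
rewrite -[p]coefK poly_def; elim/big_rec: _ => [|i q _ IH].
  by rewrite deriv0 lam0 !horner0 subrr mulr0.
rewrite derivD derivZ derivXn lamD lamZ mulrDr IH.
rewrite !hornerE expr1n mulr1 -signr_odd -scaler_nat lamZ lamXn.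
case: (val i) => [|j]/=; first by rewrite expr0; ring.
by case: (odd j); rewrite /= ?expr1 ?expr0; [ring|field; rewrite ?nat1r ?natr1 ?pnatr_eq0].
Qed.

Lemma lam_parts p q : (p * q).[1] = (p * q).[-1] -> lam (p^`() * q) = - lam (p * q^`()).
Proof.
move=> pq; apply/eqP; rewrite -addr_eq0 -lamD -derivM; apply/eqP.
have n2 : 2 != 0 :> R by rewrite pnatr_eq0.
by apply: (mulfI n2); rewrite lam_deriv pq subrr mulr0.
Qed.

Variable l : nat.
(** By Rodrigues' formula, k = l gives 2^l l! times the Legendre polynomial of degree l, and k = l +
    m the polynomial factor of the associated Legendre function of order m. *)
Definition rodrigues k : {poly R} := (('X ^+ 2 - 1) ^+ l)^`(k).
Local Notation U := rodrigues.

Lemma rodriguesS k : (U k)^`() = U k.+1.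
Proof. by rewrite /U derivnS. Qed.

(** Differentiate the first-order equation (X^2 - 1) U' = 2 l X U of U = (X^2 - 1)^l: once for k =
    0, once more at each induction step. For k = l this is Legendre's equation. *)
Lemma rodrigues_ode k :
  ('X ^+ 2 - 1) * U k.+2 + (2 * (k.+1%:R - l%:R))%:P * 'X * U k.+1
    + (k.+1%:R * (k%:R - 2 * l%:R))%:P * U k = 0.
Proof.
elim: k => [|k IHk].
  have h1 : ('X ^+ 2 - 1) * U 1 = (2 * l%:R)%:P * 'X * U 0.
    rewrite /U derivn0 derivn1 deriv_exp derivB derivXn derivC subr0 expr1.
    case: l => [|n]; first by rewrite mulr0n !mulr0 polyC0 !mul0r.
    by rewrite (exprS _ n) -mulr_natl -[_ *+ 2]mulr_natl polyCM !polyC_natr /=; ring.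
  have := congr1 (fun p => p^`()) h1.
  rewrite !derivM derivB derivXn derivC derivX !rodriguesS derivC => h.
  apply/eqP; rewrite -[X in _ == X](subrr (0 * 'X * U 0)); apply/eqP.
  move: h => /eqP; rewrite -subr_eq0 => /eqP h; rewrite subrr -[RHS]h.
  by rewrite !(polyCM, polyCB) !polyC_natr -mulr_natl; ring.
have := congr1 (fun p => p^`()) IHk.
rewrite !derivD !derivM derivB derivXn derivX !derivC ?deriv0 !rodriguesS => h.
by rewrite -[RHS]h !(polyCM, polyCB) !polyC_natr -mulr_natl; ring.
Qed.

Lemma rodrigues_coef_rec k j :
  (j.+2%:R * j.+1%:R) * (U k)`_j.+2 = (j + k).+1%:R * ((j + k)%:R - 2 * l%:R) * (U k)`_j.
Proof.
have := congr1 (fun p : {poly R} => p`_j) (rodrigues_ode k).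
rewrite -!rodriguesS !coefD coef0 -!mulrA !coefCM mulrBl mul1r coefB coefXnM coefXM !coef_deriv.
move=> h; apply/eqP; rewrite -subr_eq0 -oppr_eq0 -[X in _ == X]h; apply/eqP.
case: j {h} => [|[|j]] /=; rewrite ?subn2 /=.
- by ring.
- by ring.
- by ring.
Qed.

(** The zeros of (X^2 - 1)^l at 1 and -1 have order l, and k derivatives leave a factor (X^2 - 1)^(l
    - k). This removes the boundary terms in [lam_legendre]. *)
Lemma rodrigues_root k (e : R) : (k < l)%N -> e ^+ 2 = 1 -> (U k).[e] = 0.
Proof.
move=> kl e1; suff [g ->] : exists g, U k = ('X ^+ 2 - 1) ^+ (l - k) * g.
  by rewrite hornerM horner_exp !hornerE e1 subrr expr0n subn_eq0 leqNgt kl mul0r.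
elim: k kl => [|k IHk] kl; first by exists 1; rewrite subn0 mulr1.
have [g hg] := IHk (ltnW kl).
rewrite -rodriguesS hg subnS; have : (0 < l - k)%N by rewrite subn_gt0 ltnW.
case: (l - k)%N => // n _; rewrite /= derivM deriv_exp /= (exprS _ n).
exists (n.+1%:R * ('X ^+ 2 - 1)^`() * g + ('X ^+ 2 - 1) * g^`()).
by rewrite -[_ *+ n.+1]mulr_natl; ring.
Qed.

(** The derivative of X (X^2 - 1)^(n+1) has zero integral and equals (2n+3) (X^2 - 1)^(n+1) + (2n+2)
    (X^2 - 1)^n, whence a two-term recursion. *)
Lemma lam_weight n : lam (('X ^+ 2 - 1) ^+ n) = (-1) ^+ n * (2 ^+ n * n`!%:R) ^+ 2 / (n.*2.+1)`!%:R.
Proof.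
elim: n => [|n IHn].
  by have := lamXn 0; rewrite !expr0 => ->; rewrite double0 fact0 (_ : 1`! = 1)%N// !mulr1 expr1n mul1r divr1 invr1. 
have h : ((n.*2.+3)%:R : R) * lam (('X ^+ 2 - 1) ^+ n.+1) = - (n.*2.+2)%:R * lam (('X ^+ 2 - 1) ^+ n).
  have := lam_deriv ('X * ('X ^+ 2 - 1) ^+ n.+1).
  have -> : ('X * ('X ^+ 2 - 1) ^+ n.+1 : {poly R})^`() = (n.*2.+3)%:R *: ('X ^+ 2 - 1) ^+ n.+1 + (n.*2.+2)%:R *: ('X ^+ 2 - 1) ^+ n.
    rewrite derivM derivX deriv_exp derivB derivXn derivC subr0 expr1 -[_ *+ n.+1]mulr_natl -[_ *+ 2]mulr_natl.
    rewrite -!mul_polyC !polyC_natr -!muln2 -addn3 -addn2 !natrD !natrM (exprS _ n) /=.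
    by ring.
  rewrite !hornerM !horner_exp !hornerE sqrrN expr1n subrr expr0n/= !mulr0 subrr => /eqP.
  by rewrite mulf_eq0 pnatr_eq0/= lamD !lamZ addr_eq0 -mulNr => /eqP.
apply: (@mulfI _ (n.*2.+3)%:R); first by rewrite pnatr_eq0.
rewrite h IHn doubleS !factS !natrM !exprS -!muln2 -addn3 -addn2 !(natrD,natrM) -natr1.
by field; rewrite -!natrM nat1r -!natrD !pnatr_eq0 -lt0n fact_gt0 !addnS.
Qed.

Lemma weight_monic : ('X ^+ 2 - 1 : {poly R}) ^+ l \is monic.
Proof. by apply: monic_exp; rewrite -(polyC1 R); exact: monicXnsubC. Qed.

Lemma size_weight : size (('X ^+ 2 - 1 : {poly R}) ^+ l) = l.*2.+1.
Proof.
rewrite [LHS]polySpred ?monic_neq0 ?weight_monic// size_exp -polyC1 size_XnsubC//.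
by rewrite mul2n.
Qed.

Lemma coef_weight_odd i : odd i -> (('X ^+ 2 - 1 : {poly R}) ^+ l)`_i = 0.
Proof.
move=> oi; have -> : (('X ^+ 2 - 1 : {poly R}) ^+ l) = (('X - 1) ^+ l) \Po 'X^2.
  by rewrite rmorphXn rmorphB /= comp_polyX rmorph1.
by rewrite coef_comp_poly_Xn// dvdn2 oi.
Qed.

Lemma coef_rodrigues k i : (U k)`_i = (('X ^+ 2 - 1) ^+ l)`_(k + i) *+ (k + i) ^_ k.
Proof. exact: coef_derivn. Qed.

Lemma rodrigues_parity k i : odd (k + i) -> (U k)`_i = 0.
Proof. by move=> /coef_weight_odd; rewrite coef_rodrigues => ->; rewrite mul0rn. Qed.

Lemma size_rodrigues k : (size (U k) <= (l.*2 - k).+1)%N.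
Proof.
apply/leq_sizeP => i h.
have {}h : (l.*2 < k + i)%N by lia.
by rewrite coef_rodrigues nth_default ?mul0rn// size_weight.
Qed.

Lemma lead_rodrigues k : (k <= l.*2)%N -> (U k)`_(l.*2 - k) = (l.*2)`!%:R / (l.*2 - k)`!%:R.
Proof.
move=> kl; rewrite coef_rodrigues subnKC//.
have := monicP weight_monic; rewrite lead_coefE size_weight /= => ->.
by rewrite -[in RHS](ffact_fact kl) natrM mulfK// pnatr_eq0 -lt0n fact_gt0.
Qed.

Lemma rodrigues_top : U l.*2 = (l.*2)`!%:R%:P.
Proof.
have := size_rodrigues l.*2; rewrite subnn => /size1_polyC ->.
by have := lead_rodrigues (leqnn _); rewrite subnn fact0 divr1 => ->.
Qed.

(** Integrate by parts l times: one factor becomes the constant (2l)!, the other (X^2 - 1)^l, whose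
    integral is [lam_weight]. *)
Lemma lam_legendre : lam (U l * U l) = (2 ^+ l * l`!%:R) ^+ 2 / l.*2.+1%:R.
Proof.
have h j : (j <= l)%N -> lam (U l * U l) = (-1) ^+ j * lam (U (l + j)%N * U (l - j)%N).
  elim: j => [|j IHj] jl; first by rewrite expr0 mul1r addn0 subn0.
  rewrite IHj 1?ltnW// exprS mulN1r mulNr -mulrN; congr (_ * _).
  have -> : U (l - j)%N = (U (l - j.+1)%N)^`() by rewrite rodriguesS subnSK.
  rewrite mulrC lam_parts ?rodriguesS ?addnS 1?mulrC//.
  have lj : (l - j.+1 < l)%N by rewrite ltn_subrL ltn0Sn (leq_ltn_trans _ jl).
  have m1 : (-1) ^+ 2 = 1 :> R by rewrite sqrrN expr1n.
  by rewrite !hornerM (rodrigues_root lj (expr1n _ 2)) (rodrigues_root lj m1) !mulr0.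
rewrite (h l)// addnn subnn rodrigues_top mul_polyC lamZ lam_weight.
rewrite factS natrM mulrA; set f := (l.*2)`!%:R; set c := l.*2.+1%:R.
have f0 : f != 0 by rewrite pnatr_eq0 -lt0n fact_gt0.
have c0 : c != 0 by rewrite pnatr_eq0.
clearbody f c; transitivity (((-1) ^+ l * (-1) ^+ l) * (2 ^+ l * l`!%:R) ^+ 2 / c); first by field; rewrite c0 f0.
by rewrite -[X in X * _ / _]expr2 sqrr_sign mul1r.
Qed.

(** One integration by parts lowers m. By [rodrigues_ode] the derivative of (1 - X^2)^(m+1) q', with
    q = U (l + m), is -(l - m)(l + m + 1) (1 - X^2)^m q. *)
Lemma lam_assoc_legendre m : (m <= l)%N ->
  lam ((1 - 'X ^+ 2) ^+ m * (U (l + m)%N * U (l + m)%N)) =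
  (l + m)`!%:R / (l - m)`!%:R * ((2 ^+ l * l`!%:R) ^+ 2 / l.*2.+1%:R).
Proof.
elim: m => [|m IHm] ml.
  by rewrite expr0 mul1r addn0 lam_legendre subn0 divff ?mul1r// pnatr_eq0 -lt0n fact_gt0.
set q := U (l + m)%N.
have -> : (1 - 'X ^+ 2) ^+ m.+1 * (U (l + m.+1)%N * U (l + m.+1)%N) = q^`() * ((1 - 'X ^+ 2) ^+ m.+1 * q^`()).
  by rewrite /q rodriguesS addnS; ring.
rewrite lam_parts; last by rewrite !hornerM !horner_exp !hornerE sqrrN expr1n subrr expr0n/= !(mulr0, mul0r).
have -> : q * ((1 - 'X ^+ 2) ^+ m.+1 * q^`())^`() =
  - ((l - m)%:R * (l + m).+1%:R) *: ((1 - 'X ^+ 2) ^+ m * (q * q)).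
  have := rodrigues_ode (l + m); rewrite -!rodriguesS -/q => ode.
  rewrite derivM deriv_exp derivB derivXn derivC sub0r expr1 -[_ *+ m.+1]mulr_natl -[_ *+ 2]mulr_natl.
  rewrite -mul_polyC; move: ode; rewrite natrB 1?ltnW// (exprS _ m).
  rewrite !(polyCM, polyCB, polyCN) !polyC_natr -[(l + m).+1]addn1 !natrD -natr1 /= => ode.
  apply/eqP; rewrite -subr_eq0; apply/eqP.
  rewrite -[RHS](mul0r (- (1 - 'X ^+ 2) ^+ m * q)) -[X in _ = X * _]ode.
  by ring.
rewrite lamZ mulNr opprK IHm 1?ltnW// addnS factS.
have -> : (l - m = (l - m.+1).+1)%N by rewrite subnSK.
set j := (l - m.+1)%N; rewrite !factS !natrM; move: (_ / l.*2.+1%:R) => K.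
have j0 : j`!%:R != 0 :> R by rewrite pnatr_eq0 -lt0n fact_gt0.
have j1 : j.+1%:R != 0 :> R by rewrite pnatr_eq0.
by move: (j.+1%:R) (j`!%:R) j0 j1 => x y y0 x0; field; rewrite x0 y0.
Qed.

End Legendre.

(** * Algebraic calculus on the unit ball *)

Lemma sum_parity_ge (V : nmodType) (F : nat -> V) l N :
  (forall n, (n < l)%N || (odd n (+) odd l) -> F n = 0) ->
  \sum_(n < l + 2 * N) F n = \sum_(j < N) F (l + 2 * j)%N.
Proof.
move=> F0; elim: N => [|N IHN].
  by rewrite muln0 addn0 big_ord0 big1// => i _; rewrite F0// ltn_ord.
have -> : (l + 2 * N.+1 = (l + 2 * N).+2)%N by lia.
rewrite 3!big_ord_recr /= IHN (F0 (l + 2 * N).+1) ?addr0//.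
by rewrite /= oddD mul2n odd_double addbF; case: odd; rewrite orbT.
Qed.

Lemma sum_parity_le (V : nmodType) (F : nat -> V) n :
  (forall i, odd (i + n) -> F i = 0) ->
  \sum_(i < n.+1) F i = \sum_(i < n./2.+1) F (n - 2 * i)%N.
Proof.
elim/ltn_ind: n F => -[|[|n]] IHn F F0.
- by rewrite !big_ord_recl !big_ord0.
- by rewrite !big_ord_recl !big_ord0 F0// add0r.
rewrite 2!big_ord_recr/= (F0 n.+1) ?addSn ?addnS ?addnn/= ?odd_double// addr0.
rewrite IHn// => [|i]; last by move=> h; apply: F0; rewrite !addnS /= negbK.
rewrite [RHS]big_ord_recl/= muln0 subn0 addrC; congr (_ + _).
by apply: eq_bigr => i _; congr F; rewrite /bump /=; lia.
Qed.

Definition i0 : 'I_3 := Ordinal (isT : 0 < 3)%N.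
Definition i1 : 'I_3 := Ordinal (isT : 1 < 3)%N.
Definition i2 : 'I_3 := Ordinal (isT : 2 < 3)%N.

Lemma sum3 (V : nmodType) (F : 'I_3 -> V) : \sum_i F i = F i0 + F i1 + F i2.
Proof.
rewrite !big_ord_recr big_ord0 /= add0r.
by congr (_ + _ + _); congr F; apply: val_inj.
Qed.

Section CauchySchwarz.
Variables (R : realFieldType) (V : Type) (B : V -> V -> R) (comb : R -> V -> V -> V).
Hypothesis B_comb : forall a u v, B (comb a u v) (comb a u v) = a ^+ 2 * B u u + 2 * a * B u v + B v v.
Hypothesis B_ge0 : forall u, 0 <= B u u.

(** Only the values of the form on combinations a u + v are assumed, so that one proof serves for
    polynomials, for pairs of them and for families of reals. *)
Lemma form_cauchy_schwarz u v : B u v ^+ 2 <= B u u * B v v.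
Proof.
have [u0|u_neq0] := eqVneq (B u u) 0.
  rewrite u0 mul0r; set b := B u v.
  have [->|b_neq0] := eqVneq b 0; first by rewrite expr0n.
  (* As B u u = 0, the form is affine in the coefficient, and this coefficient gives it the value
     -1. *)
  have := B_ge0 (comb (- (B v v + 1) / (2 * b)) u v).
  rewrite B_comb u0 -/b.
  have -> : (- (B v v + 1) / (2 * b)) ^+ 2 * 0 + 2 * (- (B v v + 1) / (2 * b)) * b + B v v = -1.
    by field.
  by rewrite ler0N1.
have u_gt0 : 0 < B u u by rewrite lt_def u_neq0 B_ge0.
have := B_ge0 (comb (- B u v / B u u) u v).
rewrite B_comb.
have -> : (- B u v / B u u) ^+ 2 * B u u + 2 * (- B u v / B u u) * B u v + B v v =
   (B u u * B v v - B u v ^+ 2) / B u u by field.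
by rewrite pmulr_lge0 ?invr_gt0// subr_ge0.
Qed.
End CauchySchwarz.

Section BallCalculus.
Variables (R : rcfType) (A : comNzRingType) (k : {rmorphism R -> A}).
Variables (X : 'I_3 -> A) (D : 'I_3 -> A -> A) (I : A -> R).
Hypothesis DD : forall i f g, D i (f + g) = D i f + D i g.
Hypothesis DM : forall i f g, D i (f * g) = D i f * g + f * D i g.
Hypothesis Dk : forall i c, D i (k c) = 0.
Hypothesis DX : forall i j, D i (X j) = (i == j)%:R.
Hypothesis DC : forall i j f, D i (D j f) = D j (D i f).
Hypothesis ID : forall f g, I (f + g) = I f + I g.
Hypothesis Ik : forall c f, I (k c * f) = c * I f.
Hypothesis I_ge0 : forall f, 0 <= I (f * f).

Definition r2 : A := \sum_i X i ^+ 2.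
(* The divergence theorem on the unit ball, where the weight [1 - r2] kills the
   boundary term. *)
Hypothesis I_parts : forall i f, I ((1 - r2) * D i f) = 2 * I (X i * f).

Definition euler f := \sum_i X i * D i f.
Definition lap f := \sum_i D i (D i f).
(* The integral over the unit sphere, as the ball integral of the divergence of
   [f] times the position vector. *)
Definition sg f := I (euler f) + 3 * I f.
(** Homogeneity is Euler's identity, since the ring has derivations but no grading. *)
Definition homog (n : nat) f := euler f = n%:R * f.

Lemma I0 : I 0 = 0.
Proof. by have := Ik 0 0; rewrite mulr0 mul0r. Qed.
Lemma IN f : I (- f) = - I f.
Proof. by have := Ik (-1) f; rewrite rmorphN1 !mulN1r. Qed.
Lemma IB f g : I (f - g) = I f - I g.
Proof. by rewrite ID IN. Qed.
Lemma I_sum (J : Type) (s : seq J) (P : pred J) (F : J -> A) :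
  I (\sum_(j <- s | P j) F j) = \sum_(j <- s | P j) I (F j).
Proof. by elim/big_rec2: _ => [|j x y _ <-]; rewrite ?I0 ?ID. Qed.
Lemma I_nat n f : I (n%:R * f) = n%:R * I f.
Proof. by rewrite -(rmorph_nat k) Ik. Qed.

Lemma D0 i : D i 0 = 0.
Proof. by have := Dk i 0; rewrite rmorph0. Qed.
Lemma D1 i : D i 1 = 0.
Proof. by rewrite -(rmorph1 k) Dk. Qed.
Lemma Dkl i c f : D i (k c * f) = k c * D i f.
Proof. by rewrite DM Dk mul0r add0r. Qed.
Lemma DN i f : D i (- f) = - D i f.
Proof. by rewrite -[- f]mulN1r -(rmorphN1 k) Dkl rmorphN1 mulN1r. Qed.
Lemma D_nat i n f : D i (n%:R * f) = n%:R * D i f.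
Proof. by rewrite -(rmorph_nat k) Dkl. Qed.
Lemma D_sum i (J : Type) (s : seq J) (P : pred J) (F : J -> A) :
  D i (\sum_(j <- s | P j) F j) = \sum_(j <- s | P j) D i (F j).
Proof. by elim/big_rec2: _ => [|j x y _ <-]; rewrite ?D0 ?DD. Qed.
Lemma Dexp i f n : D i (f ^+ n) = n%:R * f ^+ n.-1 * D i f.
Proof.
case: n => [|n]; first by rewrite expr0 D1 !mul0r.
elim: n => [|n IHn]; first by rewrite expr1 expr0 !mul1r.
by rewrite exprS DM IHn /= [n.+2%:R]mulrS exprS; ring.
Qed.

Lemma D_horner i (a : nat -> R) N f :
  D i (\sum_(j < N) k (a j) * f ^+ j)
  = (\sum_(j < N.-1) k (j.+1%:R * a j.+1) * f ^+ j) * D i f.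
Proof.
case: N => [|N]; first by rewrite !big_ord0 D0 mul0r.
rewrite big_ord_recl DD D_sum expr0 mulr1 Dk add0r mulr_suml.
by apply: eq_bigr => j _; rewrite lift0 Dkl Dexp rmorphM rmorph_nat /=; ring.
Qed.

Lemma eulerD f g : euler (f + g) = euler f + euler g.
Proof. by rewrite -big_split; apply: eq_bigr => i _; rewrite DD mulrDr. Qed.
Lemma eulerM f g : euler (f * g) = euler f * g + f * euler g.
Proof.
rewrite mulr_suml mulr_sumr -big_split; apply: eq_bigr => i _ /=.
by rewrite DM; ring.
Qed.
Lemma eulerk c f : euler (k c * f) = k c * euler f.
Proof. by rewrite mulr_sumr; apply: eq_bigr => i _; rewrite Dkl mulrCA. Qed.

Lemma homog_k c : homog 0 (k c).
Proof. by rewrite /homog mul0r; apply: big1 => i _; rewrite Dk mulr0. Qed.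
Lemma homogX i : homog 1 (X i).
Proof.
rewrite /homog mul1r /euler (bigD1 i)//= DX eqxx mulr1 big1 ?addr0// => j.
by move=> /negbTE ji; rewrite DX ji mulr0.
Qed.
Lemma homogM m n f g : homog m f -> homog n g -> homog (m + n) (f * g).
Proof. by rewrite /homog eulerM natrD => -> ->; ring. Qed.
Lemma homogD n f g : homog n f -> homog n g -> homog n (f + g).
Proof. by rewrite /homog eulerD mulrDr => -> ->. Qed.
Lemma homogkl n c f : homog n f -> homog n (k c * f).
Proof. by rewrite /homog eulerk => ->; ring. Qed.
Lemma homog0 n : homog n 0.
Proof. by rewrite /homog mulr0; apply: big1 => i _; rewrite D0 mulr0. Qed.
Lemma homog_sum n (J : Type) (s : seq J) (P : pred J) (F : J -> A) :
  (forall j, P j -> homog n (F j)) -> homog n (\sum_(j <- s | P j) F j).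
Proof. by move=> h; apply: big_ind => //; [exact: homog0|exact: homogD]. Qed.
Lemma homogXn m n f : homog m f -> homog (m * n) (f ^+ n).
Proof.
move=> hf; elim: n => [|n IHn]; first by rewrite muln0 expr0 -(rmorph1 k); exact: homog_k.
by rewrite mulnS exprS; exact: homogM.
Qed.
Lemma homog_r2 : homog 2 r2.
Proof. by apply: homog_sum => i _; exact: (homogXn 2 (homogX i)). Qed.

Lemma D_r2 i : D i r2 = 2 * X i.
Proof.
rewrite D_sum (bigD1 i)//= Dexp DX eqxx expr1 mulr1 big1 ?addr0// => j.
by rewrite eq_sym => /negbTE ji; rewrite Dexp DX ji mulr0.
Qed.

Lemma D_weight i f : D i ((1 - r2) * f) = (1 - r2) * D i f + k (- 2) * (X i * f).
Proof. by rewrite DM DD DN D1 D_r2 rmorphN rmorph_nat; ring. Qed.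

(** [I_parts] applied to the second derivative, which is symmetric in i and j. The rotation fields X
    i D j - X j D i thus integrate to zero. *)
Lemma I_rot i j f : I (X i * D j f) = I (X j * D i f).
Proof.
have := I_parts i (D j f); rewrite DC I_parts.
by move/mulfI => -> //; rewrite pnatr_eq0.
Qed.

Lemma sgD f g : sg (f + g) = sg f + sg g.
Proof. by rewrite /sg eulerD !ID; ring. Qed.
Lemma sgk c f : sg (k c * f) = c * sg f.
Proof. by rewrite /sg eulerk !Ik; ring. Qed.
Lemma sg0 : sg 0 = 0.
Proof. by have := sgk 0 0; rewrite mulr0 mul0r. Qed.
Lemma sg_nat n f : sg (n%:R * f) = n%:R * sg f.
Proof. by rewrite -(rmorph_nat k) sgk. Qed.
Lemma sgN f : sg (- f) = - sg f.
Proof. by have := sgk (-1) f; rewrite rmorphN1 !mulN1r. Qed.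
Lemma sg_sum (J : Type) (s : seq J) (P : pred J) (F : J -> A) :
  sg (\sum_(j <- s | P j) F j) = \sum_(j <- s | P j) sg (F j).
Proof. by elim/big_rec2: _ => [|j x y _ <-]; rewrite ?sg0 ?sgD. Qed.
Lemma sg_homog n f : homog n f -> sg f = (n + 3)%:R * I f.
Proof. by rewrite /homog /sg natrD => ->; rewrite I_nat; ring. Qed.

(** [r2] is 1 on the sphere. In terms of [I] this is [I_parts] summed over the components X i f of a
    field whose divergence is euler f + 3 f. *)
Lemma sg_r2 f : sg (r2 * f) = sg f.
Proof.
have h : I ((1 - r2) * (euler f + 3%:R * f)) = 2 * I (r2 * f).
  transitivity (I (\sum_i (1 - r2) * D i (X i * f))).
    congr I; rewrite -mulr_sumr; congr (_ * _).
    under eq_bigr do rewrite DM DX eqxx mul1r.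
    by rewrite big_split/= sumr_const card_ord -[f *+ 3]mulr_natl addrC.
  rewrite I_sum; under eq_bigr do rewrite I_parts.
  rewrite -mulr_sumr -I_sum; congr (_ * I _).
  by rewrite mulr_suml; apply: eq_bigr => i _; ring.
move: h; rewrite mulrBl mul1r IB ID I_nat /sg eulerM homog_r2 => h.
have -> : I (2%:R * r2 * f + r2 * euler f) + 3 * I (r2 * f) =
   2 * I (r2 * f) + I (r2 * (euler f + 3%:R * f)).
  by rewrite mulrDr !ID -mulrA I_nat (mulrCA r2) I_nat; ring.
by rewrite -h; ring.
Qed.

Lemma sg_r2X n f : sg (r2 ^+ n * f) = sg f.
Proof. by elim: n => [|n IHn]; rewrite ?expr0 ?mul1r// exprS -mulrA sg_r2. Qed.

(** On the unit sphere X i is a component of the outward normal. [I_parts] leaves the term r2 D i h,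
    which differs from X i euler h by 2 X i h and by rotation fields applied to the X j h; these
    integrate to zero by [I_rot]. *)
Lemma divergence i h : I (D i h) = sg (X i * h).
Proof.
have e : I (r2 * D i h) = I (X i * euler h) + 2 * I (X i * h).
  have -> : r2 * D i h = X i * euler h + \sum_j (X j * D i (X j * h) - X i * D j (X j * h)) + 2%:R * (X i * h).
    rewrite /r2 /euler mulr_suml mulr_sumr -big_split/=.
    have -> : 2%:R * (X i * h) = \sum_j (X i * h - (i == j)%:R * (X j * h)).
      rewrite sumrB sumr_const card_ord (bigD1 i)//= eqxx mul1r big1 ?addr0.
        by rewrite -[_ *+ 3]mulr_natl; ring.
      by move=> j; rewrite eq_sym => /negbTE ->; rewrite mul0r.
    rewrite -big_split; apply: eq_bigr => j _ /=.
    by rewrite !DM !DX eqxx mulr1n; move: (_%:R) => e; ring.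
  rewrite 2!ID I_nat I_sum big1 ?addr0// => j _.
  by rewrite IB I_rot subrr.
have := I_parts i h; rewrite mulrBl mul1r IB e /sg eulerM homogX.
rewrite ID mul1r => h2.
have -> : I (D i h) = I (D i h) - (I (X i * euler h) + 2 * I (X i * h)) + (I (X i * euler h) + 2 * I (X i * h)) by ring.
by rewrite h2; ring.
Qed.

Definition grad2 f g := \sum_i I (D i f * D i g).

(** Green's first identity: the normal derivative on the unit sphere is [euler g]. *)
Lemma green f g : grad2 f g = sg (f * euler g) - I (f * lap g).
Proof.
have -> : sg (f * euler g) = \sum_i I (D i (f * D i g)).
  rewrite mulr_sumr sg_sum; apply: eq_bigr => i _.
  by rewrite divergence mulrCA.
rewrite mulr_sumr I_sum -sumrB; apply: eq_bigr => i _.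
by rewrite DM ID addrK.
Qed.

Lemma grad2C f g : grad2 f g = grad2 g f.
Proof. by apply: eq_bigr => i _; rewrite mulrC. Qed.

Lemma lapD f g : lap (f + g) = lap f + lap g.
Proof. by rewrite -big_split; apply: eq_bigr => i _; rewrite !DD. Qed.
Lemma lapk c f : lap (k c * f) = k c * lap f.
Proof. by rewrite mulr_sumr; apply: eq_bigr => i _; rewrite !Dkl. Qed.
Lemma lap0 : lap 0 = 0.
Proof. by apply: big1 => i _; rewrite !D0. Qed.
Lemma lap_sum (J : Type) (s : seq J) (P : pred J) (F : J -> A) :
  lap (\sum_(j <- s | P j) F j) = \sum_(j <- s | P j) lap (F j).
Proof. by elim/big_rec2: _ => [|j x y _ <-]; rewrite ?lap0 ?lapD. Qed.
Lemma lapM f g : lap (f * g) = lap f * g + 2%:R * (\sum_i D i f * D i g) + f * lap g.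
Proof.
rewrite /lap mulr_suml !mulr_sumr -!big_split; apply: eq_bigr => i _ /=.
by rewrite DM DD !DM; ring.
Qed.

Lemma D_r2X i j : D i (r2 ^+ j) = (2 * j)%:R * r2 ^+ j.-1 * X i.
Proof. by rewrite Dexp D_r2 natrM; ring. Qed.

Lemma lap_r2X j : lap (r2 ^+ j) = (2 * j * (2 * j + 1))%:R * r2 ^+ j.-1.
Proof.
have -> : lap (r2 ^+ j) = (2 * j)%:R * \sum_i D i (r2 ^+ j.-1 * X i).
  by rewrite mulr_sumr; apply: eq_bigr => i _; rewrite D_r2X -mulrA D_nat.
case: j => [|j]; first by rewrite !mul0r.
under eq_bigr do rewrite DM DX eqxx mulr1 D_r2X -mulrA -expr2.
rewrite /= big_split/= -mulr_sumr -/r2 sumr_const card_ord.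
case: j => [|j]; first by rewrite !mul0r add0r expr0 !natrM; ring.
by rewrite /= !natrM -mulr_natl exprS; ring.
Qed.

Lemma lap_r2XM n j f : homog n f ->
  lap (r2 ^+ j * f) = r2 ^+ j * lap f + (2 * j * (2 * j + 2 * n + 1))%:R * (r2 ^+ j.-1 * f).
Proof.
move=> hf; rewrite lapM lap_r2X.
under eq_bigr do rewrite D_r2X -mulrA.
by rewrite -mulr_sumr -/(euler f) hf !(natrM, natrD); ring.
Qed.

(** * Harmonic polynomials and their moments against powers of a linear form *)

Definition harmonic n f := homog n f /\ lap f = 0.

Lemma harmonic_comb n a b f g : harmonic n f -> harmonic n g ->
  harmonic n (k a * f + k b * g).
Proof.
move=> [hf lf] [hg lg]; split; first by apply: homogD; exact: homogkl.
by rewrite lapD !lapk lf lg !mulr0 addr0.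
Qed.

Variable kappa : R.

Section Moments.
Variables (d : 'I_3 -> R).
Hypothesis d1 : \sum_i d i ^+ 2 = 1.
Definition lform : A := \sum_i k (d i) * X i.
Local Notation t := lform.

Lemma D_lform i : D i t = k (d i).
Proof.
rewrite D_sum (bigD1 i)//= Dkl DX eqxx mulr1 big1 ?addr0// => j.
by rewrite eq_sym => /negbTE ji; rewrite Dkl DX ji mulr0.
Qed.
Lemma homog_lformX n : homog n (t ^+ n).
Proof.
rewrite -[n in homog n _]mul1n; apply: homogXn; apply: homog_sum => i _.
by apply: homogkl; exact: homogX.
Qed.
Lemma lap_lformX n : lap (t ^+ n) = (n * n.-1)%:R * t ^+ n.-2.
Proof.
transitivity (\sum_i (n * n.-1)%:R * t ^+ n.-2 * k (d i ^+ 2)).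
  apply: eq_bigr => i _; rewrite Dexp D_lform -mulrA D_nat (mulrC _ (k _)) Dkl.
  by rewrite Dexp D_lform rmorphXn natrM; ring.
by rewrite -mulr_sumr -rmorph_sum d1 rmorph1 mulr1.
Qed.

(* Green's second identity in the ball for [t ^+ n] and [S]. *)
Lemma moment_rec l n S : harmonic l S ->
  (n%:R - l%:R) * (n + l + 1)%:R * sg (t ^+ n * S) = (n * n.-1)%:R * sg (t ^+ n.-2 * S).
Proof.
move=> [hS lS]; have := grad2C (t ^+ n) S; rewrite !green lS mulr0 I0 subr0.
rewrite hS (homog_lformX n) lap_lformX !(mulrCA _ _%:R) sg_nat sg_nat I_nat !(mulrC S).
set M := sg _; set N := I _ => h.
rewrite mulrAC mulrBl h opprB addrC subrK {h}.
have [n2|] := leqP 2 n; last by move: @N; case: n @M => [|[|//]] M N; rewrite ?muln0 ?mul0n !mul0r.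
rewrite (sg_homog (homogM (homog_lformX n.-2) hS)) -/N.
have -> : (n.-2 + l + 3 = n + l + 1)%N by clear -n2; case: n n2 => [|[|n]]//= _; rewrite !addnS !addn0.
by rewrite mulrAC -mulrA.
Qed.

(** Going down from n in steps of 2 never meets l, so [moment_rec] carries the claim from n - 2 to
    n; below 2 its right side has the factor n(n - 1) = 0. *)
Lemma moment_eq0 l n S : harmonic l S ->
  (n < l)%N || (odd n (+) odd l) -> sg (t ^+ n * S) = 0.
Proof.
move=> hS; elim/ltn_ind: n => n IHn nl.
have nl0 : n%:R - l%:R != 0 :> R.
  rewrite subr_eq0 eqr_nat; apply: contraL nl => /eqP ->.
  by rewrite ltnn addbb.
have := moment_rec n hS.
have -> : (n * n.-1)%:R * sg (t ^+ n.-2 * S) = 0.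
  case: n IHn nl {nl0} => [|[|n]] IHn nl; rewrite ?mul0n ?muln0 ?mul0r//=.
  rewrite IHn ?mulr0//; move: nl; rewrite /= negbK.
  by case/orP => [/ltnW/ltnW->//|->]; rewrite orbT.
move/eqP; rewrite !mulf_eq0 (negbTE nl0)/= pnatr_eq0 addn1/=.
by move/eqP.
Qed.

(** The double factorial 3 5 ... (2n + 1), which up to a power of 2 and the square root of pi is the
    value of Gamma at n + 3/2. *)
Definition oddfact n : R := \prod_(i < n) (2 * i + 3)%:R.

Lemma oddfactS n : oddfact n.+1 = oddfact n * (2 * n + 3)%:R.
Proof. exact: big_ord_recr. Qed.
Lemma oddfact_neq0 n : oddfact n != 0.
Proof. by apply/prodf_neq0 => i _; rewrite pnatr_eq0 addn3. Qed.

Lemma oddfactE n : oddfact n * (2 ^+ n * n`!%:R) = n.*2.+1`!%:R.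
Proof.
elim: n => [|n IHn]; first by rewrite /oddfact big_ord0 expr0 !mul1r.
rewrite oddfactS doubleS (factS n.*2.+2) (factS n.*2.+1) (factS n) 3!natrM -IHn exprS.
by rewrite -[n.*2.+3]addn3 -[n.*2.+2]addn2 -[n.+1]addn1 (mulnC 2 n) -muln2 !(natrD, natrM); ring.
Qed.

(* Taylor coefficients at 0 of [s |-> j_l (kappa sqrt s) / sqrt s ^ l]. *)
Definition bessel_coef l j : R :=
  (-1) ^+ j * kappa ^+ (l + 2 * j) / (2 ^+ j * j`!%:R * oddfact (l + j)).

(** The Funk-Hecke formula term by term: [moment_rec], unrolled from l to l + 2j, turns the plane
    wave term of degree l + 2j into the j-th Bessel coefficient, up to a factor independent of j. *)
Lemma moment_closed l j S : harmonic l S ->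
  (-1) ^+ j * (kappa ^+ (l + 2 * j) / (l + 2 * j)`!%:R) * sg (t ^+ (l + 2 * j) * S)
  = oddfact l / l`!%:R * sg (t ^+ l * S) * bessel_coef l j.
Proof.
move=> hS; rewrite /bessel_coef; elim: j => [|j IHj].
  rewrite muln0 !addn0 !expr0 fact0 !mulr1.
  have := oddfact_neq0 l.
  have : l`!%:R != 0 :> R by rewrite pnatr_eq0 -lt0n fact_gt0.
  move: (sg _) (oddfact l) => a b; move: (l`!%:R) (kappa ^+ l) => c e c0 b0.
  by field; rewrite b0 c0.
have := moment_rec (l + 2 * j.+1) hS.
have -> : (l + 2 * j.+1 = (l + 2 * j).+2)%N by lia.
rewrite [n in n%:R - _](_ : _ = l + 2 * j.+1)%N; last by lia.
rewrite natrD [_ + _ - _]addrC addKr => /= h.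
have -> : (l + j.+1 = (l + j).+1)%N by rewrite addnS.
rewrite oddfactS; move: h IHj; rewrite !factS !natrM => h IHj.
have a0 : (2 * j.+1)%:R != 0 :> R by rewrite pnatr_eq0.
have b0 : ((l + 2 * j).+2 + l + 1)%:R != 0 :> R by rewrite addn1 pnatr_eq0.
set M' := sg (t ^+ (l + 2 * j).+2 * S) in h *.
set M := sg (t ^+ (l + 2 * j) * S) in h IHj.
have {}h : M' = ((l + 2 * j).+2)%:R * ((l + 2 * j).+1)%:R * M / ((2 * j.+1)%:R * ((l + 2 * j).+2 + l + 1)%:R).
  apply: (mulfI (mulf_neq0 a0 b0)); rewrite [RHS]mulrC mulfVK ?mulf_neq0//.
  by rewrite -h natrM.
have f0 : (l + 2 * j)`!%:R != 0 :> R by rewrite pnatr_eq0 -lt0n fact_gt0.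
(* From j to j + 1 both sides are multiplied by - kappa^2 / (2(j + 1) (2(l + j) + 3)). *)
transitivity ((-1) ^+ j * (kappa ^+ (l + 2 * j) / (l + 2 * j)`!%:R) * M * (- kappa ^+ 2 / ((2 * j.+1)%:R * ((l + 2 * j).+2 + l + 1)%:R))).
  rewrite h !exprS; move: a0 b0.
  have c0 : ((l + 2 * j).+2)%:R != 0 :> R by rewrite pnatr_eq0.
  have d0 : ((l + 2 * j).+1)%:R != 0 :> R by rewrite pnatr_eq0.
  move: c0 d0 f0.
  move: (l + 2 * j).+2%:R (l + 2 * j).+1%:R ((l + 2 * j)`!%:R) (2 * j.+1)%:R ((l + 2 * j).+2 + l + 1)%:R => x y z u v x0 y0 z0 u0 v0.
  by field; rewrite ?x0 ?y0 ?z0 ?u0 ?v0.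
rewrite IHj !exprS.
have -> : ((l + 2 * j).+2 + l + 1 = 2 * (l + j) + 3)%N by lia.
have o0 := oddfact_neq0 (l + j).
have p0 : (2 ^+ j * j`!%:R) != 0 :> R by rewrite mulf_neq0 ?expf_neq0 ?pnatr_eq0 -?lt0n ?fact_gt0.
have q0 : (2 * (l + j) + 3)%:R != 0 :> R by rewrite pnatr_eq0 addn3.
have j0 : j.+1%:R != 0 :> R by rewrite pnatr_eq0.
rewrite natrM; move: p0; rewrite mulf_eq0 negb_or => /andP[p0 p1].
move: (oddfact l / l`!%:R * sg (t ^+ l * S)) => C.
move: (2 ^+ j) (j`!%:R) p0 p1 j0 q0 o0 => x y x0 y0.
move: (j.+1%:R) ((2 * (l + j) + 3)%:R) (oddfact (l + j)) => z u v z0 u0 v0.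
by field; rewrite x0 y0 z0 u0 v0.
Qed.

End Moments.

(** * The inner product of the norm and its radial factor *)

Variable c2 : R.
Hypothesis c2_ge0 : 0 <= c2.
Definition inner f g := I (f * g) + c2 * grad2 f g.

Lemma innerC f g : inner f g = inner g f.
Proof. by rewrite /inner mulrC grad2C. Qed.
Lemma innerDl f g h : inner (f + g) h = inner f h + inner g h.
Proof.
rewrite /inner mulrDl ID.
have -> : grad2 (f + g) h = grad2 f h + grad2 g h.
  by rewrite -big_split; apply: eq_bigr => i _; rewrite DD mulrDl ID.
by ring.
Qed.
Lemma innerkl c f h : inner (k c * f) h = c * inner f h.
Proof.
rewrite /inner -mulrA Ik.
have -> : grad2 (k c * f) h = c * grad2 f h.
  by rewrite mulr_sumr; apply: eq_bigr => i _; rewrite Dkl -mulrA Ik.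
by ring.
Qed.
Lemma innerDr f g h : inner h (f + g) = inner h f + inner h g.
Proof. by rewrite innerC innerDl !(innerC h). Qed.
Lemma innerkr c f h : inner h (k c * f) = c * inner h f.
Proof. by rewrite innerC innerkl innerC. Qed.
Lemma inner0l h : inner 0 h = 0.
Proof. by have := innerkl 0 0 h; rewrite mulr0 mul0r. Qed.
Lemma inner_ge0 f : 0 <= inner f f.
Proof. by rewrite addr_ge0 ?mulr_ge0// sumr_ge0. Qed.
Lemma inner_suml (J : Type) (s : seq J) (P : pred J) (F : J -> A) h :
  inner (\sum_(j <- s | P j) F j) h = \sum_(j <- s | P j) inner (F j) h.
Proof. by elim/big_rec2: _ => [|j x y _ <-]; rewrite ?inner0l ?innerDl. Qed.
Lemma inner_sumr (J : Type) (s : seq J) (P : pred J) (F : J -> A) h :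
  inner h (\sum_(j <- s | P j) F j) = \sum_(j <- s | P j) inner h (F j).
Proof. by rewrite innerC inner_suml; apply: eq_bigr => j _; rewrite innerC. Qed.

Lemma I_cauchy_schwarz f g : I (f * g) ^+ 2 <= I (f * f) * I (g * g).
Proof.
apply: (@form_cauchy_schwarz _ _ (fun f g => I (f * g)) (fun a u v => k a * u + v)) => // a u v.
have -> : (k a * u + v) * (k a * u + v) = k (a ^+ 2) * (u * u) + (k (2 * a) * (u * v) + v * v).
  by rewrite rmorphXn rmorphM rmorph_nat; ring.
by rewrite !ID !Ik addrA.
Qed.

(** The inverses come from ball integrals of homogeneous elements, each being the sphere integral
    divided by the degree plus 3; the [c2] term is Green's identity. Only degrees enter, so that [f]
    and [S] count through [sg (f * S)] alone. *)
Definition radial_weight l n j : R :=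
  (n + 2 * j + l + 3)%:R^-1
  + c2 * ((2 * j + l)%:R - (2 * j * (2 * j + 2 * l + 1))%:R / (n + 2 * j + l + 1)%:R).

Lemma inner_radial l n j f S : harmonic l S -> homog n f ->
  inner f (r2 ^+ j * S) = sg (f * S) * radial_weight l n j.
Proof.
move=> [hS lS] hf.
have hr i : homog (2 * i + l) (r2 ^+ i * S).
  by apply: homogM => //; exact: homogXn homog_r2.
have sgr i : sg (f * (r2 ^+ i * S)) = sg (f * S) by rewrite mulrCA sg_r2X.
have Ir i : I (f * (r2 ^+ i * S)) = sg (f * S) / (n + (2 * i + l) + 3)%:R.
  by rewrite -(sgr i) (sg_homog (homogM hf (hr i))) mulrAC mulfV ?mul1r// ?pnatr_eq0 ?addn3.
rewrite /inner green (hr j) (lap_r2XM j hS) lS mulr0 add0r.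
rewrite !(mulrCA _ _%:R) sg_nat I_nat sgr Ir /radial_weight.
rewrite (addnA n (2 * j)%N).
case: j => [|j].
  by rewrite muln0 !mul0n !mul0r !subr0; ring.
rewrite /= Ir.
have -> : (n + (2 * j + l) + 3 = n + 2 * j.+1 + l + 1)%N by lia.
by ring.
Qed.

Definition radial (a : nat -> R) N : A := \sum_(j < N) k (a j) * r2 ^+ j.

Lemma inner_radial_sum l n a N f S : harmonic l S -> homog n f ->
  inner f (radial a N * S) = sg (f * S) * \sum_(j < N) a j * radial_weight l n j.
Proof.
move=> hS hf; rewrite mulr_suml inner_sumr mulr_sumr; apply: eq_bigr => j _.
by rewrite -mulrA innerkr (inner_radial j hS hf) mulrCA.
Qed.

Definition radial_form l (a : nat -> R) N : R :=
  \sum_(i < N) a i * \sum_(j < N) a j * radial_weight l (l + 2 * i) j.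

Lemma inner_radial_radial l a N S : harmonic l S ->
  inner (radial a N * S) (radial a N * S) = sg (S * S) * radial_form l a N.
Proof.
move=> hS; have radial_l g : inner (radial a N * S) g = \sum_(i < N) a i * inner (r2 ^+ i * S) g.
  by rewrite mulr_suml inner_suml; apply: eq_bigr => i _; rewrite -mulrA innerkl.
rewrite radial_l mulr_sumr; apply: eq_bigr => i _.
have hi : homog (l + 2 * i) (r2 ^+ i * S).
  by rewrite addnC; apply: homogM hS.1; exact: homogXn homog_r2.
by rewrite (inner_radial_sum _ _ hS hi) -mulrA sg_r2X mulrCA.
Qed.

(** * Truncated plane waves against truncated spherical waves *)

Section Cross.
Variables (d : 'I_3 -> R).
Hypothesis d1 : \sum_i d i ^+ 2 = 1.
Local Notation t := (lform d).

(** When [u n.+2 = - u n], this truncates the series of a cos(kappa t) + b sin(kappa t) with a = u 0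
    and b = u 1: the sequence [u] carries the powers of i. *)
Definition wave (u : nat -> R) N : A := \sum_(n < N) k (u n * (kappa ^+ n / n`!%:R)) * t ^+ n.

(** The moment of t^n vanishes unless n = l + 2j, so the cut at l + 2N leaves exactly N moments, one
    for each of the N Bessel terms, and by [moment_closed] the double sum is [radial_form] without
    remainder. *)
Lemma inner_wave l u v N S1 S2 : harmonic l S1 -> harmonic l S2 ->
  (forall n, u n.+2 = - u n) -> (forall n, v n.+2 = - v n) ->
  inner (wave u (l + 2 * N)) (radial (bessel_coef l) N * S1)
  + inner (wave v (l + 2 * N)) (radial (bessel_coef l) N * S2)
  = oddfact l / l`!%:R * sg (t ^+ l * (k (u l) * S1 + k (v l) * S2))
    * radial_form l (bessel_coef l) N.
Proof.
move=> h1 h2 u2 v2.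
pose T n := k (u n) * S1 + k (v n) * S2.
pose W n := \sum_(j < N) bessel_coef l j * radial_weight l n j.
have hT n : harmonic l (T n) by exact: harmonic_comb.
have uj j : u (l + 2 * j)%N = (-1) ^+ j * u l.
  elim: j => [|j IHj]; first by rewrite muln0 addn0 expr0 mul1r.
  have -> : (l + 2 * j.+1 = (l + 2 * j).+2)%N by lia.
  by rewrite u2 IHj exprS mulN1r mulNr.
have vj j : v (l + 2 * j)%N = (-1) ^+ j * v l.
  elim: j => [|j IHj]; first by rewrite muln0 addn0 expr0 mul1r.
  have -> : (l + 2 * j.+1 = (l + 2 * j).+2)%N by lia.
  by rewrite v2 IHj exprS mulN1r mulNr.
transitivity (\sum_(n < l + 2 * N) kappa ^+ n / n`!%:R * sg (t ^+ n * T n) * W n).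
  rewrite !inner_suml -big_split; apply: eq_bigr => n _ /=.
  rewrite !innerkl (inner_radial_sum _ _ h1 (homog_lformX d n)).
  rewrite (inner_radial_sum _ _ h2 (homog_lformX d n)) /T (mulrDr (t ^+ n)) sgD.
  by rewrite !(mulrCA (t ^+ n)) !sgk -/(W n); ring.
rewrite (@sum_parity_ge _ (fun n => kappa ^+ n / n`!%:R * sg (t ^+ n * T n) * W n)); last first.
  by move=> n nl; rewrite (moment_eq0 d1 (hT n) nl) mulr0 mul0r.
rewrite mulr_sumr; apply: eq_bigr => j _.
have -> : T (l + 2 * j)%N = k ((-1) ^+ j) * T l by rewrite /T uj vj !rmorphM; ring.
rewrite (mulrCA (t ^+ _)) sgk [RHS]mulrA -/(W (l + 2 * j)%N) -/(T l).
rewrite -(moment_closed d1 j (hT l)); ring.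
Qed.

(* The homogeneous polynomial of degree [n] that restricts to [q z] where [r2 = 1]. *)
Definition homogenize n (q : {poly R}) (z : A) : A :=
  \sum_(i < n./2.+1) k q`_(n - 2 * i) * (z ^+ (n - 2 * i) * r2 ^+ i).

Lemma homog_homogenize n q z : homog 1 z -> homog n (homogenize n q z).
Proof.
move=> hz; apply: homog_sum => i _; apply: homogkl.
have nE : (1 * (n - 2 * i) + 2 * i = n)%N by have := ltn_ord i; lia.
by rewrite -[X in homog X]nE; apply: homogM; apply: homogXn => //; exact: homog_r2.
Qed.

Lemma sg_homogenize n (q : {poly R}) z f : (size q <= n.+1)%N -> (forall i, odd (i + n) -> q`_i = 0) ->
  sg (homogenize n q z * f) = sg ((map_poly k q).[z] * f).
Proof.
move=> qn q0; rewrite (@horner_coef_wide _ n.+1) ?size_map_poly//.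
rewrite !mulr_suml !sg_sum.
rewrite (@sum_parity_le _ (fun i => sg ((map_poly k q)`_i * z ^+ i * f))).
  by apply: eq_bigr => i _; rewrite coef_map /= -!mulrA !sgk mulrCA sg_r2X.
by move=> i /q0; rewrite coef_map /= => ->; rewrite rmorph0 !mul0r sg0.
Qed.

Lemma harmonic1 : harmonic 0 1.
Proof.
split; first by rewrite -(rmorph1 k); exact: homog_k.
by apply: big1 => i _; rewrite D1 D0.
Qed.

(** Archimedes: on the sphere a unit linear form is uniformly distributed over [-1, 1]. The moments
    come from [moment_rec] with the harmonic 1 of degree 0. *)
Lemma sg_lformX n : sg (t ^+ n) = sg 1 * lam 'X^n.
Proof.
rewrite lamXn; elim/ltn_ind: n => -[|[|n]] IHn; first by rewrite expr0 invr1 mulr1.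
  by have := moment_eq0 d1 harmonic1 (n := 1) isT; rewrite mulr1 => ->; rewrite /= mulr0.
have := moment_rec d1 n.+2 harmonic1; rewrite !mulr1 mulr0n subr0 /= (IHn n)// addn0 addn1.
rewrite natrM -!mulrA => /mulfI; rewrite pnatr_eq0 => /(_ isT) h.
apply: (@mulfI _ n.+3%:R); first by rewrite pnatr_eq0.
rewrite h /= ?negbK; case: odd; rewrite ?mulr0//.
by rewrite [sg 1 / _]mulrC mulVKf ?pnatr_eq0// mulrCA mulfV ?mulr1 ?pnatr_eq0.
Qed.

Lemma sg_lform (q : {poly R}) : sg (map_poly k q).[t] = sg 1 * lam q.
Proof.
rewrite -[q in RHS]coefK poly_def lam_sum (@horner_coef_wide _ (size q)) ?size_map_poly//.
rewrite sg_sum mulr_sumr; apply: eq_bigr => i _.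
by rewrite coef_map /= sgk sg_lformX lamZ mulrCA.
Qed.

(** * Zonal harmonics and the pointwise bound *)

Section Zonal.
Variable l : nat.
Local Notation q := (rodrigues R l l).
(* Its restriction to the sphere is a multiple of the reproducing kernel of the
   harmonics of degree [l] at the pole [d]. *)
Definition zonal := homogenize l q t.

Lemma homog_lform : homog 1 t.
Proof. exact: (homog_lformX d 1). Qed.

Let size_q : (size q <= l.+1)%N.
Proof. by have := size_rodrigues R l l; rewrite -addnn addnK. Qed.
Let parity_q i : odd (i + l) -> q`_i = 0.
Proof. by rewrite addnC; exact: rodrigues_parity. Qed.

Lemma sg_zonal_zonal : sg (zonal * zonal) = sg 1 * ((2 ^+ l * l`!%:R) ^+ 2 / l.*2.+1%:R).
Proof.
rewrite sg_homogenize// mulrC sg_homogenize// -hornerM -rmorphM.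
by rewrite sg_lform lam_legendre.
Qed.

(** Powers of t below l have zero moment against [T], so only the leading coefficient (2l)! / l! of
    [q] counts. *)
Lemma sg_zonal_harmonic T : harmonic l T ->
  sg (zonal * T) = (l.*2)`!%:R / l`!%:R * sg (t ^+ l * T).
Proof.
move=> hT; rewrite mulr_suml sg_sum big_ord_recl big1 => [|i _] /=.
  rewrite addr0 muln0 subn0 expr0 mulr1 -mulrA sgk.
  by have := lead_rodrigues R (k := l) (l := l); rewrite -addnn leq_addr addnK => ->.
rewrite -mulrA sgk -mulrA (mulrCA (t ^+ _)) sg_r2X.
have [lt_i|lt_i] := ltnP (2 * bump 0 i) l.+1.
  by rewrite (moment_eq0 d1 hT) ?mulr0//; apply/orP; left; rewrite /bump/= in lt_i *; lia.
by have := ltn_ord i; rewrite /bump /= in lt_i *; lia.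
Qed.

(** By the reproducing property, the number squared is [sg 1] times the value of [T] at d. The bound
    itself is Cauchy-Schwarz between [T] and [zonal], and [T] is never evaluated. *)
Lemma moment_bound T : harmonic l T ->
  (oddfact l / l`!%:R * sg (t ^+ l * T)) ^+ 2 <= l.*2.+1%:R * sg 1 * sg (T * T).
Proof.
move=> hT; have hz := homog_homogenize l q homog_lform; rewrite -/zonal in hz.
(* In degree 2l the sphere integral is (2l + 3) times the ball integral, which carries
   Cauchy-Schwarz over from [I] to [sg]. *)
have e f g : homog l f -> homog l g -> sg (f * g) = (l + l + 3)%:R * I (f * g).
  by move=> hf hg; rewrite (sg_homog (homogM hf hg)).
have : sg (zonal * T) ^+ 2 <= sg (zonal * zonal) * sg (T * T).
  have hT1 := hT.1; rewrite !e//.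
  rewrite exprMn [leRHS]mulrACA -expr2 ler_wpM2l ?sqr_ge0//; exact: I_cauchy_schwarz.
rewrite sg_zonal_harmonic// sg_zonal_zonal; set M := sg (t ^+ l * T).
have := oddfactE l; rewrite factS natrM.
have : l`!%:R != 0 :> R by rewrite pnatr_eq0 -lt0n fact_gt0.
have : (l.*2)`!%:R != 0 :> R by rewrite pnatr_eq0 -lt0n fact_gt0.
have : l.*2.+1%:R != 0 :> R by rewrite pnatr_eq0.
have : 2 ^+ l != 0 :> R by rewrite expf_neq0// pnatr_eq0.
move: (sg 1) (sg (T * T)) M (oddfact l) => s1 sT M o.
move: (2 ^+ l) (l.*2.+1%:R) ((l.*2)`!%:R) (l`!%:R) => a b c e0 a0 b0 c0 e1 oE.
have -> : o = b * c / (a * e0) by rewrite -oE mulfK// mulf_neq0.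
move=> h.
have -> : (b * c / (a * e0) / e0 * M) ^+ 2 = (b / (a * e0)) ^+ 2 * (c / e0 * M) ^+ 2.
  by field; rewrite a0 e1.
apply: le_trans (ler_wpM2l (sqr_ge0 _) h) _.
rewrite le_eqVlt; apply/orP; left; apply/eqP.
by field; rewrite a0 b0 e1.
Qed.
End Zonal.

Lemma cross_bound l u v N p S1 S2 : harmonic l S1 -> harmonic l S2 ->
  (forall n, u n.+2 = - u n) -> (forall n, v n.+2 = - v n) ->
  p * (sg (S1 * S1) + sg (S2 * S2)) = sg 1 ->
  inner (wave u (l + 2 * N)) (radial (bessel_coef l) N * S1)
  + inner (wave v (l + 2 * N)) (radial (bessel_coef l) N * S2)
  <= Num.sqrt (l.*2.+1%:R * p) * Num.sqrt (u l ^+ 2 + v l ^+ 2)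
    * (inner (radial (bessel_coef l) N * S1) (radial (bessel_coef l) N * S1) +
       inner (radial (bessel_coef l) N * S2) (radial (bessel_coef l) N * S2)).
Proof.
move=> h1 h2 u2 v2 pE; rewrite (inner_wave N h1 h2 u2 v2).
have V0 : 0 <= inner (radial (bessel_coef l) N * S1) (radial (bessel_coef l) N * S1) +
   inner (radial (bessel_coef l) N * S2) (radial (bessel_coef l) N * S2).
  by rewrite addr_ge0// inner_ge0.
move: V0; rewrite (inner_radial_radial _ _ h1) (inner_radial_radial _ _ h2) -mulrDl; set rho := radial_form _ _ _.
set T := k _ * _ + _; set N2 := sg _ + sg _ => V0.
have hT : harmonic l T by exact: harmonic_comb.
have sg_ge0 n f : homog n f -> 0 <= sg (f * f).
  by move=> hf; rewrite (sg_homog (homogM hf hf)) mulr_ge0.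
have N2_ge0 : 0 <= N2 by rewrite addr_ge0// (sg_ge0 l)//; [case: h1|case: h2].
have TN2 : sg (T * T) <= (u l ^+ 2 + v l ^+ 2) * N2.
  (* Lagrange's identity: (u S1 + v S2)^2 + (u S2 - v S1)^2 = (u^2 + v^2)(S1^2 + S2^2), and the
     second square has a nonnegative integral. *)
  have hT' : harmonic l (k (u l) * S2 + k (- v l) * S1) by exact: harmonic_comb.
  have h := sg_ge0 _ _ hT'.1; rewrite -subr_ge0.
  suff -> : (u l ^+ 2 + v l ^+ 2) * N2 - sg (T * T) =
    sg ((k (u l) * S2 + k (- v l) * S1) * (k (u l) * S2 + k (- v l) * S1)) by [].
  rewrite /N2 -sgD -sgk -sgN -sgD; congr sg.
  by rewrite /T rmorphD !rmorphXn rmorphN; ring.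
have := moment_bound hT; rewrite -pE -/N2; set M := _ / _ * _ => h.
have sg1_ge0 : 0 <= p * N2 by rewrite pE -[1]mulr1; apply: sg_ge0; case: harmonic1 => h0 _; exact: h0.
have [N2_0|N2_neq0] := eqVneq N2 0.
  move: h; rewrite N2_0 !(mulr0, mul0r) => h.
  have -> : M = 0 by apply/eqP; rewrite -sqrf_eq0 eq_le h sqr_ge0.
  by rewrite mul0r.
have N2_gt0 : 0 < N2 by rewrite lt_def N2_neq0.
(* The signs of [p] and [rho] are read off from their nonnegative products with [N2]. *)
have p_ge0 : 0 <= p by rewrite -(pmulr_lge0 _ N2_gt0).
have rho_ge0 : 0 <= rho by rewrite -(pmulr_rge0 _ N2_gt0).
rewrite [leRHS]mulrA ler_wpM2r// (le_trans (ler_norm _))//.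
rewrite -(@ler_pXn2r _ 2) ?nnegrE ?mulr_ge0 ?sqrtr_ge0// real_normK ?num_real//.
clearbody M; rewrite !exprMn !sqr_sqrtr ?addr_ge0 ?sqr_ge0 ?(mulr_ge0 (ler0n _ _))//.
apply: le_trans h _; apply: le_trans (ler_wpM2l _ TN2) _; first by rewrite mulr_ge0.
by rewrite le_eqVlt; apply/orP; left; apply/eqP; ring.
Qed.

End Cross.

(** * Solid harmonics: the polynomials r^l Y(x / r) *)

Section SolidHarmonics.
Local Notation x := (X i0).
Local Notation y := (X i1).
Local Notation z := (X i2).

(* Real and imaginary part of [(x + i y) ^ m]. *)
Fixpoint planar (m : nat) : A * A :=
  if m is m'.+1 then
    let: (c, s) := planar m' in (x * c - y * s, x * s + y * c)
  else (1, 0).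

Lemma planarS m : planar m.+1 =
  (x * (planar m).1 - y * (planar m).2, x * (planar m).2 + y * (planar m).1).
Proof. by rewrite /=; case: planar. Qed.

Lemma D_planar m :
  [/\ D i0 (planar m).1 = m%:R * (planar m.-1).1,
      D i0 (planar m).2 = m%:R * (planar m.-1).2,
      D i1 (planar m).1 = - (m%:R * (planar m.-1).2) &
      D i1 (planar m).2 = m%:R * (planar m.-1).1].
Proof.
elim: m => [|m [h1 h2 h3 h4]]; first by rewrite /= !D1 !D0 !mul0r oppr0.
rewrite planarS /= !(DD, DN, DM) !DX h1 h2 h3 h4 /= !mulr0n !mulr1n !mul1r !mul0r.
case: m {h1 h2 h3 h4} => [|m]; first by rewrite /= !mul0r; split; ring.
rewrite [m.+2%:R]mulrS planarS /=; split; ring.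
Qed.

Lemma D_planar_z m : D i2 (planar m).1 = 0 /\ D i2 (planar m).2 = 0.
Proof.
elim: m => [|m [h1 h2]]; first by rewrite /= D1 D0.
by rewrite planarS /= !(DD, DN, DM) !DX h1 h2 /= !mulr0n; split; ring.
Qed.

Lemma harmonic_planar m : harmonic m (planar m).1 /\ harmonic m (planar m).2.
Proof.
have [h1 h2 h3 h4] := D_planar m; have [g1 g2] := D_planar_z m.
have [f1 f2 f3 f4] := D_planar m.-1.
split; split; rewrite /homog /euler /lap sum3 ?h1 ?h2 ?h3 ?h4 ?g1 ?g2.
- by case: m {h1 h2 h3 h4 g1 g2 f1 f2 f3 f4} => [|m]; rewrite ?planarS /=; ring.
- by rewrite D_nat DN D_nat f1 f4 D0; ring.
- by case: m {h1 h2 h3 h4 g1 g2 f1 f2 f3 f4} => [|m]; rewrite ?planarS /=; ring.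
- by rewrite D_nat D_nat f2 f3 D0; ring.
Qed.

Lemma planar_sqr m : (planar m).1 ^+ 2 + (planar m).2 ^+ 2 = (r2 - z ^+ 2) ^+ m.
Proof.
rewrite /r2 sum3 addrK; elim: m => [|m IHm]; first by rewrite /= !expr0; ring.
by rewrite planarS (exprS _ m) -IHm /=; ring.
Qed.

Variables (l m : nat).
Hypothesis ml : (m <= l)%N.
Local Notation q := (rodrigues R l (l + m)).
(** The polynomial r^(l - m) q(z / r), which together with the parts of (x + i y)^m makes up the
    solid harmonic, up to a scalar. *)
Definition axial : A := homogenize (l - m) q z.

(** [rodrigues_coef_rec] in the form met in the Laplacian: the first product comes from
    differentiating a power of z twice, the second from lowering the power of [r2]. *)
Lemma coef_rodrigues_rec i : (2 * i.+1 <= l - m)%N ->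
  ((l - m - 2 * i) * (l - m - 2 * i).-1)%:R * q`_(l - m - 2 * i)
  + (2 * i.+1 * (2 * i.+1 + 2 * (m + (l - m - 2 * i.+1)) + 1))%:R * q`_(l - m - 2 * i.+1) = 0.
Proof.
move=> il; set j := (l - m - 2 * i.+1)%N.
have -> : (l - m - 2 * i = j.+2)%N by rewrite /j; lia.
have := rodrigues_coef_rec R l (l + m) j; rewrite natrM /= => ->.
rewrite -mulrDl; apply/eqP; rewrite mulf_eq0; apply/orP; left.
have -> : ((j + (l + m))%:R - 2 * l%:R : R) = - (2 * i.+1)%:R.
  have e : (2 * l = j + (l + m) + 2 * i.+1)%N by rewrite /j; lia.
  by rewrite -natrM e [X in _ - X]natrD opprD addrA subrr sub0r.
have -> : (2 * i.+1 + 2 * (m + j) + 1 = (j + (l + m)).+1)%N by rewrite /j; lia.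
by apply/eqP; rewrite [(_ * (j + _).+1)%:R]natrM; ring.
Qed.

(** The Laplacian of a term P z^a r2^i has a part in r2^i and a part in r2^(i-1). Parts of
    neighbouring terms share a monomial and cancel by [coef_rodrigues_rec]. *)
Lemma harmonic_solid P : harmonic m P -> D i2 P = 0 -> harmonic l (P * axial).
Proof.
move=> [hP lP] zP; split.
  rewrite -(subnKC ml); apply: homogM => //.
  by apply: homog_homogenize; exact: homogX.
rewrite mulr_sumr lap_sum.
have lapF a : lap (P * z ^+ a) = (a * a.-1)%:R * (P * z ^+ a.-2).
  rewrite lapM lP mul0r add0r.
  rewrite sum3 zP !Dexp !DX /= !mulr0n !mulr0 !mul0r !addr0 mulr0 add0r.
  rewrite /lap sum3 !Dexp !DX /= !mulr0n !mulr0 !D0 !add0r mulr1.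
  by rewrite D_nat Dexp DX mulr1 natrM; ring.
have homF a : homog (m + a) (P * z ^+ a).
  by apply: homogM => //; rewrite -[a in homog a _]mul1n; exact: homogXn (homogX _).
pose G i := P * z ^+ (l - m - 2 * i).-2 * r2 ^+ i.
pose h i := q`_(l - m - 2 * i).
pose a i := (l - m - 2 * i)%N.
transitivity (\sum_(i < (l - m)./2.+1) (k (h i * (a i * (a i).-1)%:R) * G i +
   k (h i * (2 * i * (2 * i + 2 * (m + a i) + 1))%:R) * (P * z ^+ a i * r2 ^+ i.-1))).
  apply: eq_bigr => i _.
  have -> : P * (k q`_(l - m - 2 * i) * (z ^+ (l - m - 2 * i) * r2 ^+ i)) = k (h i) * (r2 ^+ i * (P * z ^+ a i)).
    by rewrite /h /a; ring.
  rewrite lapk (lap_r2XM i (homF _)) lapF /G -/(a i) !rmorphM !rmorph_nat; ring.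
rewrite big_split /= big_ord_recr [X in _ + X = _]big_ord_recl /=.
rewrite muln0 !mul0n !mulr0 rmorph0 mul0r add0r.
(* In the last term z has exponent at most 1, so its second derivative is zero. *)
have -> : (a (l - m)./2 * (a (l - m)./2).-1 = 0)%N.
  have : (a (l - m)./2 <= 1)%N by rewrite /a; lia.
  by case: a => [|[|]].
rewrite mulr0 rmorph0 mul0r addr0 -big_split big1// => i _ /=.
have il : (2 * i.+1 <= l - m)%N by have := ltn_ord i; lia.
have -> : P * z ^+ a (bump 0 i) * r2 ^+ i = G i.
  by rewrite /G /a /bump /=; congr (_ * _ ^+ _ * _); lia.
rewrite -mulrDl -rmorphD /bump /=.
have := coef_rodrigues_rec il; rewrite -/(h i.+1) -/(h i) -/(a i) -/(a i.+1) => e.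
by rewrite [X in k (X + _)]mulrC [X in k (_ + X)]mulrC e rmorph0 mul0r.
Qed.

(** On the sphere the squares of the planar parts add up to (1 - z^2)^m. What remains is a
    polynomial in z alone, integrated by [lam_assoc_legendre]. *)
Lemma sg_solid : sg ((planar m).1 * axial * ((planar m).1 * axial))
    + sg ((planar m).2 * axial * ((planar m).2 * axial)) =
  sg 1 * ((l + m)`!%:R / (l - m)`!%:R * ((2 ^+ l * l`!%:R) ^+ 2 / l.*2.+1%:R)).
Proof.
rewrite -lam_assoc_legendre// -sgD.
have -> : (planar m).1 * axial * ((planar m).1 * axial) + (planar m).2 * axial * ((planar m).2 * axial) =
  (r2 - z ^+ 2) ^+ m * (axial * axial) by rewrite -planar_sqr; ring.
have -> f : sg ((r2 - z ^+ 2) ^+ m * f) = sg ((1 - z ^+ 2) ^+ m * f).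
  elim: m f => [//|n IHn] f.
  rewrite (exprS (r2 - _) n) (exprS (1 - _) n).
  have -> : (r2 - z ^+ 2) * (r2 - z ^+ 2) ^+ n * f = (r2 - z ^+ 2) ^+ n * ((r2 - z ^+ 2) * f) by ring.
  rewrite IHn.
  have -> : (1 - z ^+ 2) ^+ n * ((r2 - z ^+ 2) * f) = r2 * ((1 - z ^+ 2) ^+ n * f) + - (z ^+ 2 * ((1 - z ^+ 2) ^+ n * f)) by ring.
  by rewrite sgD sg_r2 -sgD; congr sg; ring.
have sz : (size q <= (l - m).+1)%N.
  by have := size_rodrigues R l (l + m); rewrite -addnn subnDl.
have pz i : odd (i + (l - m)) -> q`_i = 0.
  by move=> h; apply: rodrigues_parity; lia.
(* [z] is the linear form of the third basis vector, to which [sg_lform] applies. *)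
pose d i : R := (i == i2)%:R.
have dz : lform d = z by rewrite /lform sum3 /d /= !rmorph0 rmorph1 !mul0r !add0r mul1r.
have d1 : \sum_i d i ^+ 2 = 1 by rewrite sum3 /d /= !expr0n /= !add0r expr1n.
rewrite mulrCA sg_homogenize// mulrA [_ * axial]mulrC sg_homogenize//.
rewrite -(sg_lform d1) dz !rmorphM rmorphXn rmorphB rmorphXn rmorph1 /= map_polyX.
by congr sg; rewrite !hornerM horner_exp !hornerE /=; ring.
Qed.

Lemma harmonic_solid_scaled g : harmonic l (k g * ((planar m).1 * axial))
  /\ harmonic l (k g * ((planar m).2 * axial)).
Proof.
have [h1 h2] := harmonic_planar m; have [z1 z2] := D_planar_z m.
have [g1 l1] := harmonic_solid h1 z1; have [g2 l2] := harmonic_solid h2 z2.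
by split; (split; [exact: homogkl|rewrite lapk ?l1 ?l2 mulr0]).
Qed.

(** Two scalars with equal squares, because for negative orders the sine part alone changes sign. *)
Lemma sg_solid_scaled g h : h ^+ 2 = g ^+ 2 ->
  sg (k g * ((planar m).1 * axial) * (k g * ((planar m).1 * axial)))
  + sg (k h * ((planar m).2 * axial) * (k h * ((planar m).2 * axial)))
  = g ^+ 2 * (sg 1 * ((l + m)`!%:R / (l - m)`!%:R * ((2 ^+ l * l`!%:R) ^+ 2 / l.*2.+1%:R))).
Proof.
move=> gh; have e c f : k c * f * (k c * f) = k (c ^+ 2) * (f * f) by rewrite rmorphXn; ring.
by rewrite !e !sgk gh -mulrDr sg_solid.
Qed.
End SolidHarmonics.

(** A pair stands for a real and an imaginary part, so the left side is the real part of a complex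
    inner product. *)
Lemma inner_pair_cauchy_schwarz f1 f2 g1 g2 :
  inner f1 g1 + inner f2 g2
  <= Num.sqrt (inner g1 g1 + inner g2 g2) * Num.sqrt (inner f1 f1 + inner f2 f2).
Proof.
pose B (f g : A * A) := inner f.1 g.1 + inner f.2 g.2.
have B_ge0 f : 0 <= B f f by rewrite addr_ge0// inner_ge0.
have cs : B (f1, f2) (g1, g2) ^+ 2 <= B (f1, f2) (f1, f2) * B (g1, g2) (g1, g2).
  apply: (@form_cauchy_schwarz _ _ B (fun a f g => (k a * f.1 + g.1, k a * f.2 + g.2))) => // a f g.
  rewrite /B /= !innerDl !innerDr !innerkl !innerkr (innerC g.1 f.1) (innerC g.2 f.2); ring.
apply: le_trans (ler_norm _) _.
rewrite -(@ler_pXn2r _ 2) ?nnegrE ?mulr_ge0 ?sqrtr_ge0// real_normK ?num_real//.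
by rewrite exprMn !sqr_sqrtr ?(B_ge0 (f1, f2)) ?(B_ge0 (g1, g2))// mulrC.
Qed.

(** In use, [J * S1] and [J * S2] are the parts of the truncated spherical wave, [d1] and [d2] those
    of the residual, with b = beta, c = P^(-1/2) and p = 4 pi. *)
Lemma synthesis_bound l N p S1 S2 P b c (d : 'I_P -> 'I_3 -> R) (u v : 'I_P -> nat -> R) :
  let J := radial (bessel_coef l) N in
  let V := inner (J * S1) (J * S1) + inner (J * S2) (J * S2) in
  let d1 := k b * (J * S1) + \sum_j k (- c) * wave (d j) (u j) (l + 2 * N) in
  let d2 := k b * (J * S2) + \sum_j k (- c) * wave (d j) (v j) (l + 2 * N) in
  0 <= c -> (forall j, \sum_i d j i ^+ 2 = 1) ->
  harmonic l S1 -> harmonic l S2 ->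
  (forall j n, u j n.+2 = - u j n) -> (forall j n, v j n.+2 = - v j n) ->
  p * (sg (S1 * S1) + sg (S2 * S2)) = sg 1 ->
  b * V - c * (\sum_j Num.sqrt (u j l ^+ 2 + v j l ^+ 2)) * (Num.sqrt (l.*2.+1%:R * p) * V)
  <= Num.sqrt V * Num.sqrt (inner d1 d1 + inner d2 d2).
Proof.
move=> J V d1 d2 c0 dj h1 h2 u2 v2 pE.
apply: le_trans (inner_pair_cauchy_schwarz d1 d2 (J * S1) (J * S2)).
rewrite /d1 /d2 !innerDl !innerkl !inner_suml.
set w1 := \sum_j inner _ (J * S1); set w2 := \sum_j inner _ (J * S2).
have -> : b * inner (J * S1) (J * S1) + w1 + (b * inner (J * S2) (J * S2) + w2) = b * V + (w1 + w2).
  by rewrite /V; ring.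
rewrite lerD2l /w1 /w2 -big_split mulr_sumr mulr_suml -sumrN.
apply: ler_sum => j _; rewrite /= !innerkl -mulrDr mulNr lerN2 -mulrA ler_wpM2l//.
apply: le_trans (cross_bound (dj j) N h1 h2 (u2 j) (v2 j) pE) _.
by rewrite -/J -/V le_eqVlt; apply/orP; left; apply/eqP; ring.
Qed.
End BallCalculus.

Import numFieldNormedType.Exports.
Local Open Scope classical_set_scope.
Local Open Scope ring_scope.

(** * Polynomials in three variables *)

Section LiftDerivation.
Variables (B : comNzRingType) (d : B -> B).
Hypothesis dD : forall a b, d (a + b) = d a + d b.
Hypothesis dM : forall a b, d (a * b) = d a * b + a * d b.

Lemma derivation0 : d 0 = 0.
Proof. by apply: (@addrI _ (d 0)); rewrite -dD !addr0. Qed.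
Lemma derivation1 : d 1 = 0.
Proof. by apply: (@addrI _ (d 1)); rewrite addr0 -{3}[1]mulr1 dM mulr1 mul1r. Qed.
Lemma derivation_sum n (F : 'I_n -> B) : d (\sum_i F i) = \sum_i d (F i).
Proof. by elim/big_rec2: _ => [|j x y _ <-]; rewrite ?derivation0 ?dD. Qed.

Lemma map_derivationD (p q : {poly B}) : map_poly d (p + q) = map_poly d p + map_poly d q.
Proof. by apply/polyP => i; rewrite coefD !coef_map_id0 ?derivation0// coefD dD. Qed.
Lemma map_derivationM (p q : {poly B}) :
  map_poly d (p * q) = map_poly d p * q + p * map_poly d q.
Proof.
apply/polyP => i; rewrite coefD !coef_map_id0 ?derivation0// !coefM derivation_sum -big_split.
by apply: eq_bigr => j _; rewrite !coef_map_id0 ?derivation0// dM.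
Qed.
Lemma map_derivationX : map_poly d 'X = 0.
Proof. by apply/polyP => i; rewrite coef_map_id0 ?derivation0// coefX coef0; case: eqP; rewrite ?derivation0 ?derivation1. Qed.
End LiftDerivation.

Section Poly3.
Variable R : realType.
Definition poly3 := {poly {poly {poly R}}}.
HB.instance Definition _ := GRing.ComNzRing.on poly3.
Implicit Types (p q : poly3) (x : R * R * R).

Definition cst3 : R -> poly3 := polyC \o (polyC \o polyC).
HB.instance Definition _ := GRing.RMorphism.copy cst3 (polyC \o (polyC \o polyC)).

(** The third coordinate is the outermost variable, so that [D3] reaches the other two through the
    coefficients. *)
Definition X3 (i : 'I_3) : poly3 :=
  match val i with 0 => 'X%:P%:P | 1 => 'X%:P | _ => 'X end.
Definition D3 (i : 'I_3) : poly3 -> poly3 :=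
  match val i with 0 => map_poly (map_poly (@deriv R)) | 1 => map_poly (@deriv _) | _ => @deriv _ end.

Lemma poly3_ind (P : poly3 -> Prop) :
  (forall c, P (cst3 c)) -> (forall i, P (X3 i)) ->
  (forall p q, P p -> P q -> P (p + q)) -> (forall p q, P p -> P q -> P (p * q)) ->
  forall p, P p.
Proof.
move=> Pc PX PD PM; elim/poly_ind => [|p c IHp]; first exact: (Pc 0).
apply: (PD) => //; first exact: PM _ _ IHp (PX i2).
elim/poly_ind: c => [|{IHp}p c IHp]; first exact: (Pc 0).
rewrite polyCD polyCM; apply: (PD) => //; first exact: PM _ _ IHp (PX i1).
elim/poly_ind: c => [|{IHp}p c IHp]; first exact: (Pc 0).
rewrite !polyCD !polyCM; apply: (PD) => //; first exact: PM _ _ IHp (PX i0).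
exact: Pc.
Qed.

Lemma D3D i p q : D3 i (p + q) = D3 i p + D3 i q.
Proof.
case: i => [[|[|[|//]]]] ? /=; [|exact: map_derivationD (@derivD _) _ _|exact: derivD].
by apply: map_derivationD; apply: map_derivationD; exact: derivD.
Qed.
Lemma D3M i p q : D3 i (p * q) = D3 i p * q + p * D3 i q.
Proof.
case: i => [[|[|[|//]]]] ? /=; last exact: derivM.
  apply: map_derivationM; first by apply: map_derivationD; exact: derivD.
  by apply: map_derivationM; [exact: derivD|exact: derivM].
by apply: map_derivationM; [exact: derivD|exact: derivM].
Qed.
Lemma D3C i c : D3 i (cst3 c) = 0.
Proof.
case: i => [[|[|[|//]]]] ?; rewrite /D3 /cst3 /=; last exact: derivC.
  by rewrite map_polyC /= map_polyC /= derivC !polyC0.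
by rewrite map_polyC /= derivC polyC0.
Qed.
Lemma D3X i j : D3 i (X3 j) = (i == j)%:R.
Proof.
have e := @derivation0 _ (@deriv R) (@derivD R).
have e' := @derivation0 _ (@deriv {poly R}) (@derivD _).
have f0 : map_poly (@deriv R) 0 = 0 by rewrite map_poly0.
case: i => [[|[|[|//]]]] ?; case: j => [[|[|[|//]]]] ?; rewrite /D3 /X3 -val_eqE /=.
- by rewrite map_polyC /= map_polyC /= derivX !polyC1.
- rewrite map_polyC /= map_derivationX ?polyC0//; [exact: derivD|exact: derivM].
- rewrite map_derivationX//; [apply: map_derivationD; exact: derivD|].
  by apply: map_derivationM; [exact: derivD|exact: derivM].
- by rewrite map_polyC /= derivC polyC0.
- by rewrite map_polyC /= derivX polyC1.
- by rewrite map_derivationX//; [exact: derivD|exact: derivM].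
- by rewrite derivC.
- by rewrite derivC.
- by rewrite derivX.
Qed.
Lemma D3_comm i j p : D3 i (D3 j p) = D3 j (D3 i p).
Proof.
have D0 i' : D3 i' 0 = 0 by have := D3C i' 0; rewrite rmorph0.
have Dn i' n : D3 i' n%:R = 0 by have := D3C i' n%:R; rewrite rmorph_nat.
elim/poly3_ind: p => [c|j'|p q Hp Hq|p q Hp Hq].
- by rewrite !D3C ?D0.
- by rewrite !D3X !Dn.
- by rewrite !D3D Hp Hq.
- by rewrite !(D3M, D3D) Hp Hq; ring.
Qed.

Definition ev x p : R := p.[x.2%:P%:P].[x.1.2%:P].[x.1.1].

Lemma evD x p q : ev x (p + q) = ev x p + ev x q.
Proof. by rewrite /ev !hornerD. Qed.
Lemma evM x p q : ev x (p * q) = ev x p * ev x q.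
Proof. by rewrite /ev !hornerM. Qed.
Lemma evC x c : ev x (cst3 c) = c.
Proof. by rewrite /ev !hornerC. Qed.

Definition coord (i : 'I_3) x : R :=
  match val i with 0 => x.1.1 | 1 => x.1.2 | _ => x.2 end.
Definition upd (i : 'I_3) x t : R * R * R :=
  match val i with 0 => (t, x.1.2, x.2) | 1 => (x.1.1, t, x.2) | _ => (x.1.1, x.1.2, t) end.

Lemma evX x i : ev x (X3 i) = coord i x.
Proof. by case: i => [[|[|[|//]]]] ?; rewrite /ev /X3 /coord /= !(hornerC, hornerX). Qed.

Lemma coord_upd i j x t : coord j (upd i x t) = if i == j then t else coord j x.
Proof. by case: i => [[|[|[|//]]]] ?; case: j => [[|[|[|//]]]] ?. Qed.
Lemma upd_id i x : upd i x (coord i x) = x.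
Proof. by case: x => [[a b] c]; case: i => [[|[|[|//]]]] ?. Qed.
Lemma is_derive_ev p (i : 'I_3) x (t : R) : is_derive t (1 : R) (fun s => ev (upd i x s) p) (ev (upd i x t) (D3 i p)).
Proof.
elim/poly3_ind: p => [c|j|p q Hp Hq|p q Hp Hq].
- rewrite D3C; have -> : ev (upd i x t) 0 = 0 by rewrite -(rmorph0 cst3) evC.
  have -> : (fun s => ev (upd i x s) (cst3 c)) = cst c by apply/funext => s; rewrite evC.
  exact: is_derive_cst.
- rewrite D3X; have -> : ev (upd i x t) (i == j)%:R = (i == j)%:R by rewrite -(rmorph_nat cst3) evC.
  have [<-|ij] := eqVneq i j.
    have -> : (fun s => ev (upd i x s) (X3 i)) = id.
      by apply/funext => s; rewrite evX coord_upd eqxx.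
    exact: is_derive_id.
  have -> : (fun s => ev (upd i x s) (X3 j)) = cst (coord j x).
    by apply/funext => s; rewrite evX coord_upd (negbTE ij).
  exact: is_derive_cst.
- have -> : (fun s => ev (upd i x s) (p + q)) = (fun s => ev (upd i x s) p) \+ (fun s => ev (upd i x s) q).
    by apply/funext => s; rewrite evD.
  by rewrite D3D evD; exact: is_deriveD.
- have -> : (fun s => ev (upd i x s) (p * q)) = ((fun s => ev (upd i x s) p) : R -> R) * (fun s => ev (upd i x s) q).
    by apply/funext => s; rewrite evM.
  rewrite D3M evD !evM; apply: (is_derive_eq (is_deriveM Hp Hq)).
  rewrite /GRing.scale /=; ring.
Qed.

Lemma continuous_ev p (i : 'I_3) x : continuous (fun s => ev (upd i x s) p).
Proof.
move=> s; apply: differentiable_continuous; apply/derivable1_diffP.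
by case: (is_derive_ev p i x s).
Qed.

Lemma measurable_ev p : measurable_fun setT (fun x => ev x p).
Proof.
elim/poly3_ind: p => [c|j|p q Hp Hq|p q Hp Hq].
- by under eq_fun do rewrite evC; exact: measurable_cst.
- under eq_fun do rewrite evX; rewrite /coord.
  case: j => [[|[|[|//]]]] ? /=.
  + exact: measurableT_comp measurable_fst measurable_fst.
  + exact: measurableT_comp measurable_snd measurable_fst.
  + exact: measurable_snd.
- by under eq_fun do rewrite evD; exact: measurable_funD.
- by under eq_fun do rewrite evM; exact: measurable_funM.
Qed.

Lemma unit_ballE x : unit_ball x <-> \sum_i coord i x ^+ 2 < 1.
Proof.
rewrite sum3 /unit_ball /= /vnorm /vdot -!expr2 /coord /=.
by rewrite -[X in _ < X]sqrtr1 ltr_sqrt.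
Qed.

Lemma coord_ball i x : unit_ball x -> `|coord i x| <= 1.
Proof.
move=> /unit_ballE xB; rewrite -(expr_le1 (n := 2))// real_normK ?num_real//.
apply/ltW/(le_lt_trans _ xB); rewrite (bigD1 i)//= lerDl.
by apply: sumr_ge0 => j _; exact: sqr_ge0.
Qed.

Lemma ev_bounded p : exists K, forall x, unit_ball x -> `|ev x p| <= K.
Proof.
elim/poly3_ind: p => [c|j|p q [Kp Hp] [Kq Hq]|p q [Kp Hp] [Kq Hq]].
- by exists `|c| => x _; rewrite evC.
- by exists 1 => x; rewrite evX; exact: coord_ball.
- by exists (Kp + Kq) => x xB; rewrite evD (le_trans (ler_normD _ _))// lerD ?Hp ?Hq.
- by exists (Kp * Kq) => x xB; rewrite evM normrM ler_pM ?Hp ?Hq.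
Qed.

Lemma measurable_unit_ball : measurable (@unit_ball R).
Proof.
have e x : ev x (\sum_i X3 i ^+ 2) = \sum_i coord i x ^+ 2.
  by rewrite !sum3 !evD !expr2 !evM !evX.
have -> : @unit_ball R = (fun x => ev x (\sum_i X3 i ^+ 2)) @^-1` `]-oo, 1[.
  by apply/seteqP; split => x; rewrite unit_ballE /= in_itv /= e.
by rewrite -[X in measurable X]setTI; apply: measurable_ev => //; exact: measurable_itv.
Qed.
End Poly3.

(** * Integration over the unit ball *)

Section Fubini3.
Local Open Scope ereal_scope.
Context d1 d2 d3 (T1 : measurableType d1) (T2 : measurableType d2) (T3 : measurableType d3) (R : realType).
Variables (m1 : {sigma_finite_measure set T1 -> \bar R}) (m2 : {sigma_finite_measure set T2 -> \bar R})
  (m3 : {sigma_finite_measure set T3 -> \bar R}) (g : T1 * T2 * T3 -> \bar R).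
Hypothesis ig : ((m1 \x m2) \x m3).-integrable setT g.
(* Packed by hand, because inference does not find the sigma-finite structure of
   [m1 \x m2]. *)
Let M12 : {sigma_finite_measure set (T1 * T2)%type -> \bar R} :=
  HB.pack_for {sigma_finite_measure set (T1 * T2)%type -> \bar R} (m1 \x m2)
    (lebesgue_integral_fubini.measure_function_Measure_isSigmaFinite__to__measure_function_isSigmaFinite m1 m2)
    (lebesgue_integral_fubini.measure_function_Measure_isSigmaFinite__to__measure_function_isSFinite m1 m2).
Let ig' : (M12 \x m3).-integrable setT g := ig.
Lemma fubini3_inner :
  \int[(m1 \x m2) \x m3]_x g x = \int[m1 \x m2]_u \int[m3]_t g (u, t).
Proof. exact: (esym (@integral12_prod_meas1 _ _ _ _ R M12 m3 g ig')). Qed.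
Lemma fubini3_outer :
  \int[(m1 \x m2) \x m3]_x g x = \int[m3]_t \int[m1 \x m2]_u g (u, t).
Proof. exact: (esym (@integral21_prod_meas1 _ _ _ _ R M12 m3 g ig')). Qed.
End Fubini3.

Section BallIntegral.
Variable R : realType.
Local Notation mu := (@lebesgue_measure R).
Local Notation mu2 := (@lebesgue_measure R \x @lebesgue_measure R)%E.
Local Notation mu3 := (@lebesgue_measure3 R).
Local Notation T1 := (measurableTypeR R).
Local Notation T3 := (T1 * T1 * T1)%type.
Implicit Types (p q : poly3 R) (x : R * R * R).

Lemma mball : measurable (@unit_ball R : set T3).
Proof. exact (@measurable_unit_ball R). Qed.
Lemma mev p : measurable_fun (setT : set T3) (fun x : T3 => ev x p : T1).
Proof. exact (@measurable_ev R p). Qed.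

(** The fundamental theorem of calculus on a chord of the ball: the set is empty or the interval
    between the two square roots of [c], where [F] vanishes. *)
Lemma integral_slice (c : R) (F f : R -> R) :
  (forall t : R, is_derive t (1 : R) F (f t)) -> continuous f ->
  (forall t, t ^+ 2 = c -> F t = 0) ->
  (\int[mu]_t ((f \_ [set t | t ^+ 2 < c]) t)%:E = 0)%E.
Proof.
move=> dF cf F0.
have -> : (fun t => ((f \_ [set t | t ^+ 2 < c]) t)%:E) = (EFin \o f) \_ [set t | t ^+ 2 < c].
  by rewrite restrict_EFin.
rewrite -integral_mkcond.
have [c0|c0] := leP c 0.
  rewrite (_ : [set t | _] = set0) ?integral_set0//.
  by apply/seteqP; split => // t /=; rewrite ltNge (le_trans c0) ?sqr_ge0.
set s := Num.sqrt c; have s0 : 0 < s by rewrite sqrtr_gt0.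
have s2 : s ^+ 2 = c by rewrite sqr_sqrtr// ltW.
have -> : [set t | t ^+ 2 < c] = `](- s), s[%classic.
  apply/seteqP; split => t; rewrite /= in_itv /= -ltr_norml -s2.
    by rewrite -[t ^+ 2]real_normK ?num_real// ltr_pXn2r// nnegrE ltW.
  by rewrite -[t ^+ 2]real_normK ?num_real// ltr_pXn2r// nnegrE ltW.
have mf : measurable_fun setT f by exact: continuous_measurable_fun.
rewrite -(@integral_itv_bndoo _ _ _ _ true false); last first.
  by apply/measurable_EFinP; exact: measurable_funTS.
have cF t : derivable F t 1 by case: (dF t).
have contF t : {for t, continuous F} by apply: differentiable_continuous; exact/derivable1_diffP.
rewrite (continuous_FTC2 (F := F)).
- by rewrite !F0 ?sqrrN// subee.
- by rewrite gtrN.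
- exact: continuous_subspaceT.
- split; first by move=> t _.
  + by apply: cvg_at_right_filter; exact: contF.
  + by apply: cvg_at_left_filter; exact: contF.
- by move=> t _; rewrite derive1E; case: (dF t).
Qed.

Let J : set R := `[-1, 1]%classic.
Let mJ : measurable J. Proof. exact: measurable_itv. Qed.
Let muJ : (mu J < +oo)%E.
Proof. by rewrite /J lebesgue_measure_itv /= lte_fin; case: ifP => // _; rewrite -EFinB ltry. Qed.

Lemma mu2_box : (mu2 (J `*` J) < +oo)%E.
Proof. by rewrite product_measure1E//; apply: lte_mul_pinfty => //; rewrite ge0_fin_numE. Qed.
Lemma mu3_box : (mu3 (J `*` J `*` J) < +oo)%E.
Proof.
rewrite /lebesgue_measure3 product_measure1E//; last exact: measurableX.
by apply: lte_mul_pinfty => //; rewrite ge0_fin_numE// mu2_box.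
Qed.

Lemma ball_box : @unit_ball R `<=` J `*` J `*` J.
Proof.
move=> x xB; rewrite /J /= !in_itv /= -!ler_norml.
by have := (coord_ball i0 xB, coord_ball i1 xB, coord_ball i2 xB); rewrite /coord /= => -[[-> ->] ->].
Qed.

Lemma ball_finite : (mu3 (@unit_ball R) < +oo)%E.
Proof.
apply: le_lt_trans mu3_box; apply: le_measure; rewrite ?inE.
- exact: mball.
- by apply: measurableX => //; apply: measurableX.
- exact: ball_box.
Qed.

Lemma ev_integrable p : mu3.-integrable unit_ball (EFin \o (fun x => ev x p)).
Proof.
apply: measurable_bounded_integrable.
- exact: mball.
- exact: ball_finite.
- by apply: measurable_funTS; exact: mev.
- have [K HK] := ev_bounded p; exists K; split; first exact: num_real.
  move=> M KM x xB; apply: (le_trans (HK x xB)); exact: ltW.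
Qed.

Definition Iball p : R := \int[mu3]_(x in unit_ball) ev x p.

Lemma IballD p q : Iball (p + q) = Iball p + Iball q.
Proof.
rewrite /Iball; under eq_Rintegral do rewrite evD.
by apply: RintegralD; [exact: mball|exact: ev_integrable|exact: ev_integrable].
Qed.
Lemma IballZ c p : Iball (cst3 c * p) = c * Iball p.
Proof.
rewrite /Iball; under eq_Rintegral do rewrite evM evC.
by apply: RintegralZl; [exact: mball|exact: ev_integrable].
Qed.
Lemma Iball_ge0 p : 0 <= Iball (p * p).
Proof. by apply: Rintegral_ge0 => x _; rewrite evM -expr2 sqr_ge0. Qed.

Lemma coordK x : x = (coord i0 x, coord i1 x, coord i2 x).
Proof. by case: x => [[]]. Qed.

Section Slices.
Variables (i : 'I_3) (f : poly3 R).
Let h := (1 - r2 (@X3 R)) * f.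
Let g : T3 -> T1 := (fun x => ev x (D3 i h)) \_ unit_ball.

Lemma ev_r2 x : ev x (1 - r2 (@X3 R)) = 1 - \sum_j coord j x ^+ 2.
Proof.
have evN p : ev x (- p) = - ev x p by rewrite /ev !hornerN.
have -> : 1 = cst3 (1 : R) by rewrite rmorph1.
by rewrite evD evC evN /r2 !sum3 !evD !expr2 !evM !evX.
Qed.

Let slice0 x : (\int[mu]_t (g (upd i x t))%:E = 0)%E.
Proof.
(* [c] is the squared half-length of the chord through [x] in direction [i] (no chord if it is not
   positive); the weight in [h] vanishes at both ends. *)
set c := 1 - \sum_(j | j != i) coord j x ^+ 2.
have sumE t : \sum_j coord j (upd i x t) ^+ 2 = t ^+ 2 + (1 - c).
  rewrite (bigD1 i)//= coord_upd eqxx; congr (_ + _).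
  transitivity (\sum_(j | j != i) coord j x ^+ 2); last by rewrite /c; ring.
  apply: eq_bigr => j ji.
  by rewrite coord_upd eq_sym (negbTE ji).
have -> : (fun t => (g (upd i x t))%:E) =
  (fun t => (((fun t => ev (upd i x t) (D3 i h)) \_ [set t | t ^+ 2 < c]) t)%:E).
  apply/funext => t; congr EFin; rewrite /g /patch.
  suff -> : (upd i x t \in @unit_ball R) = (t \in [set t | t ^+ 2 < c]) by [].
  apply/idP/idP; rewrite !inE unit_ballE sumE /=; lra.
apply: (@integral_slice c (fun t => ev (upd i x t) h)).
- by move=> t; exact: is_derive_ev.
- exact: continuous_ev.
- by move=> t tc; rewrite /h evM ev_r2 sumE tc; ring.
Qed.

Let g_bounded : exists K, forall x, `|g x| <= K.
Proof.
have [K HK] := ev_bounded (D3 i h); exists (Num.max K 0) => x.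
rewrite /g /patch; case: ifPn => [|_]; last by rewrite normr0 le_max lexx orbT.
by rewrite inE => xB; rewrite le_max HK.
Qed.

Let mg : measurable_fun (setT : set T3) g.
Proof. by apply/(measurable_restrictT _ mball)/measurable_funTS; exact: mev. Qed.

Let ig : mu3.-integrable setT (EFin \o g).
Proof.
rewrite /g -restrict_EFin; apply/integrable_restrict => //; first exact: mball.
by rewrite setTI; exact: ev_integrable.
Qed.

(** Fubini's theorem in the plane is applied at every height [z], not almost every one; boundedness
    and support in a square give integrability on each slice. *)
Let ig2 (z : R) : mu2.-integrable setT (fun u => (g (u, z))%:E).
Proof.
have mgz : measurable_fun (setT : set (T1 * T1)) (fun u => g (u, z)).
  exact: measurable_fun_pair1.
have [K HK] := g_bounded.
have -> : (fun u => (g (u, z))%:E) = (EFin \o (fun u => g (u, z))) \_ (J `*` J).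
  apply/funext => u; rewrite /patch; case: ifPn => // uJ.
  rewrite /g /patch; case: ifPn => // uB; exfalso.
  move: uJ; rewrite notin_setE; apply.
  by move: uB; rewrite inE => /ball_box[].
apply/integrable_restrict => //; first exact: measurableX.
rewrite setTI; apply: measurable_bounded_integrable.
- exact: measurableX.
- exact: mu2_box.
- exact: measurable_funTS.
- by exists K; split; [exact: num_real|move=> M KM u _; apply: (le_trans (HK _)); exact: ltW].
Qed.

(** Fubini's theorem with the variable [i] integrated innermost: by [slice0] every line integral is
    zero. *)
Lemma integral_D3_eq0 : (\int[mu3]_(x in unit_ball) (ev x (D3 i h))%:E = 0)%E.
Proof.
rewrite integral_mkcond.
have -> : ((fun x => (ev x (D3 i h))%:E) \_ unit_ball) = (EFin \o g).
  by rewrite -restrict_EFin.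
have [iE|[iE|iE]] : i = i2 \/ i = i1 \/ i = i0.
  by case: (i) => [[|[|[|//]]]] ?; [right; right|right; left|left]; apply: val_inj.
- rewrite (@fubini3_inner _ _ _ T1 T1 T1 R mu mu mu _ ig); apply: integral0_eq => u _.
  by have := slice0 (u, 0); rewrite iE; case: u.
all: rewrite (@fubini3_outer _ _ _ T1 T1 T1 R mu mu mu _ ig); apply: integral0_eq => z _.
- rewrite -(@integral12_prod_meas1 _ _ T1 T1 R mu mu _ (ig2 z)).
  by apply: integral0_eq => a _; have := slice0 (a, 0, z); rewrite iE.
- rewrite -(@integral21_prod_meas1 _ _ T1 T1 R mu mu _ (ig2 z)).
  by apply: integral0_eq => a _; have := slice0 (0, a, z); rewrite iE.
Qed.
End Slices.

Lemma Iball_parts i f : Iball ((1 - r2 (@X3 R)) * D3 i f) = 2 * Iball (X3 R i * f).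
Proof.
have := integral_D3_eq0 i f => h0.
have : Iball (D3 i ((1 - r2 (@X3 R)) * f)) = 0 by rewrite /Iball /Rintegral h0.
have -> : D3 i ((1 - r2 (@X3 R)) * f) = (1 - r2 (@X3 R)) * D3 i f + cst3 (- 2) * (X3 R i * f).
  exact: (@D_weight _ _ (@cst3 R) (@X3 R) (@D3 R) (@D3D R) (@D3M R) (@D3C R) (@D3X R)).
by rewrite IballD IballZ => /eqP; rewrite addr_eq0 mulNr opprK => /eqP.
Qed.
End BallIntegral.

(** * Polynomial approximation in the norm *)

Lemma ordinal3 (i : 'I_3) : i = i0 \/ i = i1 \/ i = i2.
Proof. by case: i => [[|[|[|//]]]] ?; [left|right; left|right; right]; apply: val_inj. Qed.

(** * Power series dominated by an exponential series *)

Section EntireSeries.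
Variable R : realType.
Implicit Types (a : R^nat) (C M s : R).

(** This growth condition gives convergence everywhere and bounds on partial sums uniform in their
    length, and it survives termwise differentiation. *)
Definition exp_bounded a C M := 0 <= C /\ 0 <= M /\ forall n, `|a n| <= C * M ^+ n / n`!%:R.

Lemma exp_bounded_diffs a C M : exp_bounded a C M -> exp_bounded (pseries_diffs a) (C * M) M.
Proof.
move=> [C0 [M0 aM]]; split; first exact: mulr_ge0.
split=> // n; rewrite /pseries_diffs normrM ger0_norm ?ler0n//.
apply: le_trans (ler_wpM2l (ler0n _ _) (aM n.+1)) _.
rewrite le_eqVlt; apply/orP; left; apply/eqP.
rewrite factS natrM exprS; have : n`!%:R != 0 :> R by rewrite pnatr_eq0 -lt0n fact_gt0.
have : n.+1%:R != 0 :> R by rewrite pnatr_eq0.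
by move: n.+1%:R (n`!%:R) => u v u0 v0; field; rewrite u0 v0.
Qed.

Lemma exp_bounded_term a C M s n : exp_bounded a C M ->
  `|a n * s ^+ n| <= C * exp_coeff (M * `|s|) n.
Proof.
move=> [C0 [M0 aM]]; rewrite normrM normrX /exp_coeff /=.
apply: le_trans (ler_wpM2r (exprn_ge0 _ (normr_ge0 _)) (aM n)) _.
by rewrite exprMn le_eqVlt; apply/orP; left; apply/eqP; ring.
Qed.

Lemma exp_bounded_cvg a C M s : exp_bounded a C M -> cvgn (pseries a s).
Proof.
move=> aM; have [C0 [M0 _]] := aM; apply: normed_cvg.
apply: (@series_le_cvg _ _ (fun n => C * exp_coeff (M * `|s|) n)) => [n|n|n|].
- exact: normr_ge0.
- by rewrite mulr_ge0// exp_coeff_ge0// mulr_ge0.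
- exact: exp_bounded_term.
- by apply: is_cvg_seriesZ; exact: is_cvg_series_exp_coeff.
Qed.

Lemma exp_bounded_partial a C M s B N : exp_bounded a C M -> `|s| <= B ->
  `|\sum_(k < N) a k * s ^+ k| <= C * expR (M * B).
Proof.
move=> aM sB; have [C0 [M0 _]] := aM.
have Ms0 : 0 <= M * `|s| by rewrite mulr_ge0.
apply: le_trans (ler_norm_sum _ _ _) _.
apply: (@le_trans _ _ (\sum_(k < N) C * exp_coeff (M * `|s|) k)).
  by apply: ler_sum => k _; exact: exp_bounded_term aM.
rewrite -mulr_sumr ler_wpM2l//.
have Mexp : expR (M * `|s|) <= expR (M * B) by rewrite ler_expR ler_wpM2l.
apply: le_trans Mexp; rewrite /expR.
have := @nondecreasing_cvgn_le R (series (exp_coeff (M * `|s|))) _ (is_cvg_series_exp_coeff _) N.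
rewrite /series /= big_mkord; apply.
by apply/nondecreasing_seqP => n; rewrite big_nat_recr//= lerDl exp_coeff_ge0.
Qed.

Definition entire a s := limn (pseries a s).

Lemma is_derive_entire a C M s : exp_bounded a C M ->
  is_derive s (1 : R) (entire a) (entire (pseries_diffs a) s).
Proof.
move=> aM; have aM1 := exp_bounded_diffs aM; have aM2 := exp_bounded_diffs aM1.
apply: (@pseries_snd_diffs _ _ (`|s| + 1)); [exact: exp_bounded_cvg aM|exact: exp_bounded_cvg aM1|exact: exp_bounded_cvg aM2|].
by rewrite [ltRHS]ger0_norm ?addr_ge0// ltrDl.
Qed.
End EntireSeries.

(** * Approximation by polynomials together with first derivatives *)

Section Approx.
Variable R : realType.
Implicit Types (x : R * R * R) (f g : R * R * R -> R) (p q : nat -> poly3 R).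
Local Notation T1 := (measurableTypeR R).
Local Notation T3 := (T1 * T1 * T1)%type.
Local Notation mu3 := (@lebesgue_measure3 R).
Let o : R * R * R := (0, 0, 0).

Definition partial (i : 'I_3) f x : R := derive1 (fun t => f (upd i x t)) (coord i x).

Lemma sqgradE f x : sqgrad f x = \sum_i partial i f x ^+ 2.
Proof. by rewrite sum3. Qed.

(* The origin is excluded, where the spherical waves may have junk values. *)
Record approx f p : Prop := Approx {
  approx_cvg : forall x, x <> o -> (fun N => ev x (p N)) @ \oo --> f x;
  approx_derive : forall i x, x <> o ->
    derivable (fun t : R => f (upd i x t)) (coord i x) (1 : R) /\
    (fun N => ev x (D3 i (p N))) @ \oo --> partial i f x;
  approx_bounded : exists K, forall N x, unit_ball x ->
    `|ev x (p N)| <= K /\ forall i, `|ev x (D3 i (p N))| <= K }.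

Lemma partial_is_derive i f x d : is_derive (coord i x) (1 : R) (fun t => f (upd i x t)) d ->
  partial i f x = d.
Proof. by move=> fd; rewrite /partial derive1E; exact: derive_val. Qed.

Lemma approx_is_derive f p i x : approx f p -> x <> o ->
  is_derive (coord i x) (1 : R) (fun t => f (upd i x t)) (partial i f x).
Proof. by move=> [_ fd _] xo; have [h _] := fd i x xo; rewrite /partial derive1E; exact: DeriveDef. Qed.

Lemma approxD f g p q : approx f p -> approx g q ->
  approx (fun x => f x + g x) (fun N => p N + q N).
Proof.
move=> fp gq; have [fc fd [K fK]] := fp; have [gc gd [L gL]] := gq; split.
- move=> x xo; under eq_fun do rewrite evD.
  by apply: cvgD; [exact: fc|exact: gc].
- move=> i x xo.
  have h : is_derive (coord i x) (1 : R) (fun t => f (upd i x t) + g (upd i x t)) (partial i f x + partial i g x).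
    by apply: is_deriveD; [exact: approx_is_derive fp xo|exact: approx_is_derive gq xo].
  split; first by case: h.
  rewrite (partial_is_derive h); under eq_fun do rewrite D3D evD.
  by apply: cvgD; [exact: (fd i x xo).2|exact: (gd i x xo).2].
- exists (K + L) => N x xB; have [h1 h2] := fK N x xB; have [h3 h4] := gL N x xB.
  split; first by rewrite evD (le_trans (ler_normD _ _))// lerD.
  by move=> i; rewrite D3D evD (le_trans (ler_normD _ _))// lerD.
Qed.

Lemma approxM f p (q : poly3 R) : approx f p ->
  approx (fun x => f x * ev x q) (fun N => p N * q).
Proof.
move=> fp; have [fc fd [K fK]] := fp; split.
- move=> x xo; under eq_fun do rewrite evM.
  by apply: cvgMr_tmp; exact: fc.
- move=> i x xo.
  have h : is_derive (coord i x) (1 : R) (fun t => f (upd i x t) * ev (upd i x t) q)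
     (partial i f x * ev x q + f x * ev x (D3 i q)).
    have h1 := approx_is_derive i fp xo.
    have h2 := is_derive_ev q i x (coord i x).
    have := is_deriveM h1 h2; rewrite !upd_id => h3.
    by apply: (is_derive_eq h3); rewrite /GRing.scale /=; ring.
  split; first by case: h.
  rewrite (partial_is_derive h); under eq_fun do rewrite D3M evD !evM.
  by apply: cvgD; apply: cvgMr_tmp; [exact: (fd i x xo).2|exact: fc].
- have [L qL] := ev_bounded q.
  have [L' qL'] : exists L', forall i x, unit_ball x -> `|ev x (D3 i q)| <= L'.
    have [L0 H0] := ev_bounded (D3 i0 q); have [L1 H1] := ev_bounded (D3 i1 q).
    have [L2 H2] := ev_bounded (D3 i2 q).
    exists (`|L0| + `|L1| + `|L2|) => i x xB.
    have := (H0 x xB, H1 x xB, H2 x xB) => -[[h0 h1] h2].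
    have := (ler_norm L0, ler_norm L1, ler_norm L2, normr_ge0 L0, normr_ge0 L1, normr_ge0 L2) => -[[[[[n0 n1] n2] p0] p1] p2].
    case: i => [[|[|[|//]]]] ?.
    + rewrite [Ordinal _](_ : _ = i0); last exact: val_inj.
      lra.
    + rewrite [Ordinal _](_ : _ = i1); last exact: val_inj.
      lra.
    + rewrite [Ordinal _](_ : _ = i2); last exact: val_inj.
      lra.
  exists (`|K| * L + `|K| * L') => N x xB; have [h1 h2] := fK N x xB.
  have hK := ler_norm K.
  have L0 : 0 <= L by exact: le_trans (normr_ge0 _) (qL x xB).
  have L'0 : 0 <= L' by exact: le_trans (normr_ge0 _) (qL' i0 x xB).
  split.
    rewrite evM normrM; apply: le_trans (_ : `|K| * L <= _); last by rewrite lerDl mulr_ge0.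
    by rewrite ler_pM// ?qL// (le_trans h1).
  move=> i; rewrite D3M evD !evM (le_trans (ler_normD _ _))// !normrM lerD//.
    by rewrite ler_pM// ?qL// (le_trans (h2 i)).
  by rewrite ler_pM// ?qL'// (le_trans h1).
Qed.

Lemma approxZ c f p : approx f p -> approx (fun x => c * f x) (fun N => cst3 c * p N).
Proof.
move=> /(approxM (cst3 c)).
have -> : (fun x => f x * ev x (cst3 c)) = (fun x => c * f x).
  by apply/funext => x; rewrite evC mulrC.
by have -> : (fun N => p N * cst3 c) = (fun N => cst3 c * p N) by apply/funext => N; rewrite mulrC.
Qed.

Lemma approx_sum n (f : 'I_n -> R * R * R -> R) (p : 'I_n -> nat -> poly3 R) :
  (forall j, approx (f j) (p j)) ->
  approx (fun x => \sum_j f j x) (fun N => \sum_j p j N).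
Proof.
elim: n f p => [|n IHn] f p fp.
  have -> : (fun x => \sum_(j < 0) f j x) = (fun=> 0) by apply/funext => x; rewrite big_ord0.
  have -> : (fun N => \sum_(j < 0) p j N) = (fun=> 0) by apply/funext => x; rewrite big_ord0.
  have ev0 x : ev x 0 = 0 by rewrite -(rmorph0 (@cst3 R)) evC.
  have D30 i : D3 i (0 : poly3 R) = 0 by have := D3C i (0 : R); rewrite rmorph0.
  split=> [x _|i x _|]; first by under eq_fun do rewrite ev0; exact: cvg_cst.
    split; first exact: derivable_cst.
    rewrite (_ : partial _ _ _ = 0); last by apply: partial_is_derive; exact: is_derive_cst.
    by under eq_fun do rewrite D30 ev0; exact: cvg_cst.
  by exists 0 => N x _; split=> [|i]; rewrite ?D30 ev0 normr0.
have -> : (fun x => \sum_(j < n.+1) f j x) = (fun x => f ord0 x + \sum_j f (lift ord0 j) x).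
  by apply/funext => x; rewrite big_ord_recl.
have -> : (fun N => \sum_(j < n.+1) p j N) = (fun N => p ord0 N + \sum_j p (lift ord0 j) N).
  by apply/funext => N; rewrite big_ord_recl.
by apply: approxD => //; apply: IHn.
Qed.

Lemma approx_subseq f p (h : nat -> nat) : h @ \oo --> \oo -> approx f p -> approx f (p \o h).
Proof.
move=> hoo [fc fd [K fK]]; split.
- by move=> x xo; exact: cvg_comp hoo (fc x xo).
- by move=> i x xo; split; [exact: (fd i x xo).1|exact: cvg_comp hoo (fd i x xo).2].
- by exists K => N; exact: fK.
Qed.

(** Lets functions that agree off the origin be differentiated alike. On the i-th axis the moving
    coordinate is nonzero and stays so nearby; off it, another coordinate is nonzero and does not
    move. *)
Lemma near_upd i x : x <> o -> \forall t \near coord i x, upd i x t <> o.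
Proof.
move=> xo; have [h|/existsNP[j /not_implyP[ji cj]]] := pselect (forall j, j != i -> coord j x = 0).
  have ci : coord i x != 0.
    apply: contra_notN xo => /eqP ci; rewrite (coordK x) /o.
    have c j : coord j x = 0 by have [->//|/h] := eqVneq j i.
    by rewrite !c.
  near=> t; have t0 : t != 0 by near: t; exact: (cvgr_neq0 _ (@cvg_id _ (nbhs (coord i x))) ci).
  by move=> uo; have := congr1 (coord i) uo; rewrite coord_upd eqxx; case: (i) t0 => [[|[|[|//]]]] ? /eqP.
near=> t => uo; apply: cj; have := congr1 (coord j) uo.
by rewrite coord_upd eq_sym (negbTE ji) => ->; case: (j) => [[|[|[|//]]]].
Unshelve. all: by end_near. Qed.

Lemma approx_eq f g p : (forall x, x <> o -> f x = g x) -> approx f p -> approx g p.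
Proof.
move=> fg fp; have [fc fd [K fK]] := fp; split.
- by move=> x xo; rewrite -fg//; exact: fc.
- move=> i x xo.
  have h : is_derive (coord i x) (1 : R) (fun t => g (upd i x t)) (partial i f x).
    apply: (near_eq_is_derive _ (approx_is_derive i fp xo)).
    by apply: filterS (near_upd i xo) => t to; rewrite fg.
  by split; [case: h|rewrite (partial_is_derive h); exact: (fd i x xo).2].
- by exists K.
Qed.

Lemma ev_sum x n (F : 'I_n -> poly3 R) : ev x (\sum_i F i) = \sum_i ev x (F i).
Proof.
elim/big_rec2: _ => [|i u v _ <-]; last by rewrite evD.
by rewrite -(rmorph0 (@cst3 R)) evC.
Qed.
Lemma ev_exp x (q : poly3 R) n : ev x (q ^+ n) = ev x q ^+ n.
Proof.
elim: n => [|n IHn]; first by rewrite !expr0 -(rmorph1 (@cst3 R)) evC.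
by rewrite !exprS evM IHn.
Qed.

Lemma ev_horner x (a : nat -> R) (q : poly3 R) N :
  ev x (\sum_(k < N) cst3 (a k) * q ^+ k) = pseries a (ev x q) N.
Proof.
rewrite ev_sum /pseries /series /= big_mkord; apply: eq_bigr => k _.
by rewrite evM evC ev_exp.
Qed.

Lemma approx_entire a C M (q : poly3 R) : exp_bounded a C M ->
  approx (fun x => entire a (ev x q)) (fun N => \sum_(k < N) cst3 (a k) * q ^+ k).
Proof.
move=> aM; have aM1 := exp_bounded_diffs aM.
have DE i N : D3 i (\sum_(k < N) cst3 (a k) * q ^+ k) =
   (\sum_(k < N.-1) cst3 (pseries_diffs a k) * q ^+ k) * D3 i q.
  exact: (@D_horner _ _ (@cst3 R) (@D3 R) (@D3D R) (@D3M R) (@D3C R)).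
split.
- by move=> x _; under eq_fun do rewrite ev_horner; exact: exp_bounded_cvg aM.
- move=> i x _.
  have h : is_derive (coord i x) (1 : R) (fun t => entire a (ev (upd i x t) q))
     (entire (pseries_diffs a) (ev x q) * ev x (D3 i q)).
    have h1 := is_derive_ev q i x (coord i x).
    have h2 := is_derive_entire (ev (upd i x (coord i x)) q) aM.
    by have := @is_derive1_comp R (entire a) (fun s => ev (upd i x s) q) (coord i x) _ _ h2 h1; rewrite !upd_id.
  split; first by case: h.
  rewrite (partial_is_derive h); under eq_fun do rewrite DE evM ev_horner.
  (* Differentiating a partial sum loses its constant term, hence the shift of the index. *)
  apply: cvgMr_tmp; rewrite -cvg_shiftS /=; exact: exp_bounded_cvg aM1.
have [B qB] := ev_bounded q.
have [L0 H0] := ev_bounded (D3 i0 q); have [L1 H1] := ev_bounded (D3 i1 q).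
have [L2 H2] := ev_bounded (D3 i2 q).
have bnd b C' N x : exp_bounded b C' M -> unit_ball x ->
    `|ev x (\sum_(k < N) cst3 (b k) * q ^+ k)| <= C' * expR (M * B).
  move=> bM xB; rewrite ev_horner /pseries /series /= big_mkord.
  by apply: exp_bounded_partial => //; exact: qB.
exists (C * expR (M * B) + C * M * expR (M * B) * (`|L0| + `|L1| + `|L2|)) => N x xB.
have [C0 [M0 _]] := aM.
have e0 := expR_ge0 (M * B).
split; first by rewrite (le_trans (bnd _ _ N _ aM xB))// lerDl !mulr_ge0 ?addr_ge0.
move=> i; rewrite DE evM normrM.
apply: (@le_trans _ _ (C * M * expR (M * B) * (`|L0| + `|L1| + `|L2|))); last by rewrite lerDr mulr_ge0.
apply: ler_pM => //; first exact: bnd aM1 xB.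
have := (H0 x xB, H1 x xB, H2 x xB) => -[[h0 h1] h2].
have := (ler_norm L0, ler_norm L1, ler_norm L2, normr_ge0 L0, normr_ge0 L1, normr_ge0 L2) => -[[[[[n0 n1] n2] p0] p1] p2].
by case: (ordinal3 i) => [->|[->|->]]; lra.
Qed.

Lemma mu3_origin : mu3 [set o] = 0%E.
Proof.
have -> : [set o] = [set 0] `*` [set 0] `*` [set 0] :> set (R * R * R).
  by apply/seteqP; split => [x ->//|[[a b] c] [[/= -> ->] ->]].
rewrite /lebesgue_measure3 product_measure1E//; last exact: measurableX.
by rewrite [X in (_ * X)%E](_ : _ = 0%E) ?mule0//; exact: (lebesgue_measure_set1 0).
Qed.

(** Dominated convergence with a constant majorant, integrable because the ball has finite volume;
    the origin is a null set. *)
Lemma Iball_cvg (h : nat -> poly3 R) (H : R * R * R -> R) :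
  (forall x, x <> o -> (fun N => ev x (h N)) @ \oo --> H x) ->
  (exists K, forall N x, unit_ball x -> `|ev x (h N)| <= K) ->
  (fun N => Iball (h N)) @ \oo --> \int[mu3]_(x in unit_ball) H x.
Proof.
move=> hH [K hK].
have mo : measurable ([set o] : set T3).
  have -> : [set o] = [set 0] `*` [set 0] `*` [set 0] :> set (R * R * R).
    by apply/seteqP; split => [x ->//|[[a b] c] [[/= -> ->] ->]].
  by apply: measurableX => //; exact: measurableX.
have mbo : measurable ((@unit_ball R : set T3) `\` [set o]) by apply: measurableD => //; exact: mball.
(* [H] is arbitrary at the origin: it is measurable on the punctured ball as a limit, and a single
   point is then added. *)
have mH : measurable_fun (@unit_ball R : set T3) (EFin \o H : T3 -> \bar R).
  have -> : (@unit_ball R : set T3) = (@unit_ball R `\` [set o]) `|` [set o].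
    rewrite setDE setUIl setUCl setIT setUidl// => x ->.
    by rewrite /unit_ball /= /vnorm /vdot /= !mulr0 !addr0 sqrtr0.
  apply/measurable_funU => //; split; last exact: measurable_fun_set1.
  apply: (@emeasurable_fun_cvg _ _ _ _ (fun N x => (ev x (h N))%:E)) => [N|x [_ xo]].
    by apply/measurable_EFinP; apply: measurable_funTS; exact: mev.
  by apply: cvg_EFin; [exact: nearW|exact: hH].
have [|||||iH _ hcvg] := @dominated_convergence _ T3 R mu3 (@unit_ball R) (@mball R) (fun N x => (ev x (h N))%:E) (EFin \o H) (EFin \o (fun x => ev x (cst3 K))).
- by move=> N; apply/measurable_EFinP; apply: measurable_funTS; exact: mev.
- exact: mH.
- exists [set o]; split => //; first exact: mu3_origin.
  move=> x /= /not_implyP[_ nx]; apply: contrapT => xo; apply: nx.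
  by apply: cvg_EFin; [exact: nearW|exact: hH].
- exact: ev_integrable.
- by apply: aeW => x N xB /=; rewrite lee_fin evC; exact: hK.
have fin : (\int[mu3]_(x in unit_ball) (H x)%:E)%E \is a fin_num by exact: (integrable_fin_num (@mball R) iH).
by apply: fine_cvg; rewrite fineK.
Qed.

(** * Convergence of the norms of the approximants *)

Section NormB.
Variable kappa : R.
Definition innerB := inner (@D3 R) (@Iball R) (kappa ^- 2).

Lemma normB_cvg (u : R * R * R -> R[i]) p q :
  approx (fun x => complex.Re (u x)) p -> approx (fun x => complex.Im (u x)) q ->
  (fun N => Num.sqrt (innerB (p N) (p N) + innerB (q N) (q N))) @ \oo --> normB kappa u.
Proof.
move=> up uq; have [pc pd [K pK]] := up; have [qc qd [L qL]] := uq.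
have sq (w : nat -> R) (c : R) : w @ \oo --> c -> (fun N => w N * w N) @ \oo --> c ^+ 2.
  by move=> wc; rewrite expr2; exact: cvgM.
have sqle (a b : R) : `|a| <= b -> `|a| ^+ 2 <= b ^+ 2.
  by move=> ab; rewrite ler_sqr ?nnegrE// (le_trans _ ab).
have e0 : (fun N => Iball (p N * p N + q N * q N)) @ \oo --> sqnormL2 u.
  apply: Iball_cvg => [x xo|].
    under eq_fun do rewrite evD !evM.
    by apply: cvgD; apply: sq; [exact: pc|exact: qc].
  exists (K ^+ 2 + L ^+ 2) => N x xB; have [h1 _] := pK N x xB; have [h2 _] := qL N x xB.
  rewrite evD !evM (le_trans (ler_normD _ _))// !normrM -!expr2.
  by rewrite lerD// sqle.
have e1 : (fun N => Iball (\sum_i (D3 i (p N) * D3 i (p N)) + \sum_i (D3 i (q N) * D3 i (q N)))) @ \oo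
   --> sqnormL2_grad u.
  apply: Iball_cvg => [x xo|].
    rewrite !sqgradE !sum3; under eq_fun do rewrite evD !ev_sum !sum3 !evM.
    apply: cvgD; (apply: cvgD; first apply: cvgD); apply: sq.
    - exact: (pd i0 x xo).2.
    - exact: (pd i1 x xo).2.
    - exact: (pd i2 x xo).2.
    - exact: (qd i0 x xo).2.
    - exact: (qd i1 x xo).2.
    - exact: (qd i2 x xo).2.
  exists (\sum_(i < 3) K ^+ 2 + \sum_(i < 3) L ^+ 2) => N x xB; have [_ h1] := pK N x xB; have [_ h2] := qL N x xB.
  rewrite evD !ev_sum (le_trans (ler_normD _ _))//.
  by apply: lerD; (apply: le_trans (ler_norm_sum _ _ _) _);
    apply: ler_sum => i _; rewrite evM normrM -expr2 sqle.
have -> : (fun N => Num.sqrt (innerB (p N) (p N) + innerB (q N) (q N))) =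
  (fun N => Num.sqrt (Iball (p N * p N + q N * q N) + kappa ^- 2 *
    Iball (\sum_i (D3 i (p N) * D3 i (p N)) + \sum_i (D3 i (q N) * D3 i (q N))))).
  apply/funext => N; congr Num.sqrt.
  rewrite /innerB /inner /grad2 !IballD !sum3 !IballD; ring.
apply: continuous_cvg; first exact: sqrt_continuous.
by apply: cvgD => //; exact: cvgMl_tmp.
Qed.
End NormB.
End Approx.

(** * The Gamma function at half-integers *)

Section GammaHalfIntegers.
Variable R : realType.
Implicit Types (a t L : R).
Local Notation E := (@gauss_integral_proof.integral0_gauss R).

(* [L] is the value of Gamma at [a + 1], witnessed by a primitive, to which the
   fundamental theorem of calculus applies. *)
Definition gamma_primitive a L := exists F : R -> R,
  [/\ forall t, 0 < t -> is_derive t (1 : R) F (t `^ a * expR (- t)),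
      F t @[t --> 0^'+] --> F 0, F 0 = 0 & F t @[t --> +oo] --> L].

Lemma powR_expRN_cvgy a : t `^ a * expR (- t) @[t --> +oo] --> (0 : R).
Proof.
have [n an] : exists n : nat, a <= n%:R.
  by exists (Num.bound `|a|); apply/ltW/(le_lt_trans (ler_norm _))/archi_boundP/normr_ge0.
(* The majorant comes from t^a <= t^n for t >= 1 and exp t >= t^(n+1) / (n+1)!. *)
apply: (@squeeze_cvgr _ _ _ _ (cst 0) (fun t : R => (n.+1)`!%:R * t^-1)).
- near=> t; have t1 : 1 <= t by near: t; exact: nbhs_pinfty_ge.
  have t0 : 0 < t by exact: lt_le_trans t1.
  rewrite mulr_ge0 ?powR_ge0 ?expR_ge0//= expRN ler_pdivrMr ?expR_gt0//.
  apply: (@le_trans _ _ (t ^+ n)); first by rewrite -powR_mulrn ?(ltW t0)//; exact: (ler_powR t1).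
  rewrite mulrAC ler_pdivlMr// -exprSr.
  rewrite -ler_pdivrMl ?ltr0n ?fact_gt0// mulrC.
  by apply: le_trans (expR_ge1Dxn n (ltW t0)); rewrite lerDr.
- exact: cvg_cst.
- rewrite -[X in _ --> X](mulr0 (n.+1)`!%:R); apply: cvgMl_tmp.
  by apply/gtr0_cvgV0; [exact: nbhs_pinfty_gt|exact: cvg_id].
Unshelve. all: by end_near. Qed.

Lemma powR_expRN_cvg0 a : 0 < a -> t `^ a * expR (- t) @[t --> 0^'+] --> (0 : R).
Proof.
move=> a0; rewrite -[X in _ --> X](mul0r (expR (- 0))).
apply: cvgM; first exact: powR_cvg0.
apply: cvg_at_right_filter; apply: (@continuous_comp _ _ _ (@GRing.opp R) expR); last exact: continuous_expR.
exact: opp_continuous.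
Qed.

Lemma is_derive_powR_expRN a t : 0 < t ->
  is_derive t (1 : R) (fun t => t `^ a * expR (- t))
    (a * t `^ (a - 1) * expR (- t) - t `^ a * expR (- t)).
Proof.
move=> t0; have h1 := is_derive1_powR a t0.
have h2 : is_derive t (1 : R) (fun t => expR (- t)) (- expR (- t)).
  have h3 : is_derive t (1 : R) (fun t : R => - t) (-1) by exact: is_deriveNid.
  have := @is_derive1_comp R expR (fun t => - t) t _ _ (is_derive_expR _) h3.
  by rewrite mulrN1.
by apply: (is_derive_eq (is_deriveM h1 h2)); rewrite /GRing.scale /=; ring.
Qed.

(** The functional equation of Gamma on primitives: integration by parts, with a boundary term
    t^(a+1) exp(-t) that tends to 0 at both ends. *)
Lemma gamma_primitiveS a L : 0 < a -> gamma_primitive a L -> gamma_primitive (a + 1) ((a + 1) * L).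
Proof.
move=> a0 [F [dF F0 F00 FL]].
have a1 : 0 < a + 1 by rewrite addr_gt0.
exists (fun t => (a + 1) * F t - t `^ (a + 1) * expR (- t)); split.
- move=> t t0; have h1 := dF t t0; have h2 := is_derive_powR_expRN (a + 1) t0.
  have h3 := is_deriveB (is_deriveZ (a + 1) h1) h2.
  by apply: (is_derive_eq h3); rewrite /GRing.scale /= addrK; ring.
- rewrite F00 powR0 ?gt_eqF// mul0r mulr0 subr0 -[X in _ --> X]subr0.
  apply: cvgB; last exact: powR_expRN_cvg0.
  by rewrite -[X in _ --> X](mulr0 (a + 1)); apply: cvgMl_tmp; rewrite F00 in F0.
- by rewrite F00 powR0 ?gt_eqF// mul0r mulr0 subr0.
- rewrite -[X in _ --> X]subr0; apply: cvgB; last exact: powR_expRN_cvgy.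
  exact: cvgMl_tmp.
Qed.

Lemma Gamma_primitive a L : 0 < a -> gamma_primitive a L -> Gamma (a + 1) = L.
Proof.
move=> a0 [F [dF F0 F00 FL]].
have cont t : 0 < t -> {for t, continuous (fun t => t `^ a * expR (- t))}.
  move=> t0; apply: differentiable_continuous; apply/derivable1_diffP.
  by case: (is_derive_powR_expRN a t0).
have mf : measurable_fun (`]0, +oo[%classic : set R) (fun t => t `^ a * expR (- t)).
  apply: open_continuous_measurable_fun => // t; rewrite inE /= in_itv /= andbT.
  exact: cont.
rewrite /Gamma addrK /Rintegral integral_itv_obnd_cbnd; last first.
  by apply/measurable_EFinP; exact mf.
rewrite (@ge0_continuous_FTC2y R _ F 0 L) ?F00 ?sube0//.
- by move=> t t0; rewrite mulr_ge0 ?powR_ge0 ?expR_ge0.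
- apply/continuous_within_itvcyP; split.
    by move=> t; rewrite in_itv /= andbT; exact: cont.
  rewrite powR0 ?gt_eqF// mul0r; exact: powR_expRN_cvg0.
- by move=> t t0; case: (dF t t0).
- by rewrite F00 in F0 *.
- by move=> t; rewrite in_itv /= andbT derive1E => t0; case: (dF t t0).
Qed.

(** Substituting t = u^2 and integrating by parts leads to the primitive E(sqrt t) - sqrt t exp(-t),
    where E is the Gauss integral from 0, of limit sqrt(pi) / 2. *)
Lemma gamma_primitive_half : gamma_primitive 2^-1 (Num.sqrt pi / 2).
Proof.
have E0 : E 0 = 0 by rewrite /gauss_integral_proof.integral0_gauss set_itv1 Rintegral_set1.
have iE u : (@lebesgue_measure R).-integrable `[0, u] (EFin \o @gauss_fun R).
  apply: continuous_compact_integrable; first exact: segment_compact.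
  by apply: continuous_subspaceT; exact: continuous_gauss_fun.
have dE (u : R) : 0 < u -> is_derive u (1 : R) E (gauss_fun u).
  move=> u0; have [] := @continuous_FTC1_closed R (@gauss_fun R) 0 u (u + 1) _ (iE _) u0 _.
  - by rewrite ltrDl.
  - exact: continuous_gauss_fun.
  - by move=> h1 h2; rewrite -h2 derive1E; exact: DeriveDef.
have Ey : E t @[t --> +oo] --> Num.sqrt pi / 2.
  have : Num.sqrt (E t ^+ 2) @[t --> +oo] --> Num.sqrt (pi / 4).
    by apply: continuous_cvg; [exact: sqrt_continuous|exact: gauss_integral_proof.cvg_integral0_gauss_sqr].
  rewrite sqrtrM ?pi_ge0// sqrtrV// (_ : 4 = 2 ^+ 2); last by rewrite expr2 -natrM.
  rewrite sqrtr_sqr ger0_norm// (_ : (fun t => Num.sqrt (E t ^+ 2)) = E)//.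
  apply/funext => t; rewrite sqrtr_sqr ger0_norm//.
  exact: gauss_integral_proof.integral0_gauss_ge0.
have py : (t : R) `^ 2^-1 @[t --> +oo] --> +oo.
  apply/cvgryPge => A; near=> t.
  have t0 : A ^+ 2 <= t by near: t; apply: nbhs_pinfty_ge; exact: num_real.
  rewrite powR12_sqrt ?(le_trans (sqr_ge0 A))// (le_trans (ler_norm A))//.
  by rewrite -sqrtr_sqr; apply: ler_wsqrtr.
exists (fun t => E (t `^ 2^-1) - t `^ 2^-1 * expR (- t)); split.
- move=> t t0; have p0 : 0 < t `^ 2^-1 by exact: powR_gt0.
  have h1 := @is_derive1_comp R E (fun t => t `^ 2^-1) t _ _ (dE _ p0) (is_derive1_powR 2^-1 t0).
  have h2 := is_derive_powR_expRN 2^-1 t0.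
  apply: (is_derive_eq (is_deriveB h1 h2)).
  by rewrite /gauss_fun powR12_sqrt ?ltW// sqr_sqrtr ?ltW//; ring.
- rewrite powR0 ?invr_eq0 ?pnatr_eq0// E0 mul0r subr0 -[X in _ --> X]subr0.
  apply: cvgB; last by apply: powR_expRN_cvg0; rewrite invr_gt0.
  have p0 : (t : R) `^ 2^-1 @[t --> 0^'+] --> (0 : R) by apply: powR_cvg0; rewrite invr_gt0.
  apply: (cvg_comp _ _ p0).
  exact: (@parameterized_integral_cvg_left R 0 1 (@gauss_fun R) ltr01 (iE 1)).
- by rewrite powR0 ?invr_eq0 ?pnatr_eq0// E0 mul0r subr0.
- rewrite -[X in _ --> X]subr0; apply: cvgB; last exact: powR_expRN_cvgy.
  exact: (cvg_comp _ _ py Ey).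
Unshelve. all: by end_near. Qed.

(** The Bessel series of order l + 1/2 calls for Gamma at arguments from 3/2 on. The induction
    starts there, where the integrand is continuous at 0. *)
Lemma Gamma_half n : Gamma (n%:R + 2^-1 + 1 : R) = oddfact R n / 2 ^+ n.+1 * Num.sqrt pi.
Proof.
have h2 : 0 < 2^-1 :> R by rewrite invr_gt0.
apply: Gamma_primitive; first by rewrite ltr_wpDl.
elim: n => [|n IHn].
  rewrite add0r /oddfact big_ord0 expr1 (_ : 1 / 2 * Num.sqrt pi = Num.sqrt pi / 2); last by ring.
  exact: gamma_primitive_half.
have -> : n.+1%:R + 2^-1 = n%:R + 2^-1 + 1 :> R by rewrite -natr1; ring.
have -> : oddfact R n.+1 / 2 ^+ n.+2 * Num.sqrt pi = (n%:R + 2^-1 + 1) * (oddfact R n / 2 ^+ n.+1 * Num.sqrt pi).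
  by rewrite oddfactS natrD natrM exprS; field; rewrite expf_neq0.
by apply: gamma_primitiveS.
Qed.
End GammaHalfIntegers.

(** * Spherical waves *)

Section Spherical.
Variable R : realType.
Implicit Types (x y : R * R * R) (kappa r : R).

Lemma circle_angle (a b : R) : a ^+ 2 + b ^+ 2 = 1 ->
  exists t, [/\ 0 <= t < 2 * pi, cos t = a & sin t = b].
Proof.
move=> ab; have a1 : -1 <= a <= 1.
  rewrite -ler_norml -(expr_le1 (n := 2))// real_normK ?num_real//.
  by rewrite -ab lerDl sqr_ge0.
have p0 := pi_gt0 R; have g0 := acos_ge0 a1; have gp := acos_lepi a1.
have cosa : cos (acos a) = a by apply: acosK.
have sina : sin (acos a) = `|b|.
  by rewrite sin_acos// -ab addrAC subrr add0r sqrtr_sqr.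
have [b0|b0] := leP 0 b.
  by exists (acos a); split; [lra|exact: cosa|rewrite sina ger0_norm].
have alt : a < 1.
  case/andP: a1 => _ a1; rewrite lt_neqAle a1 andbT; apply/eqP => a1'.
  have /eqP : b ^+ 2 = 0 by rewrite a1' expr1n in ab; lra.
  by rewrite sqrf_eq0 => /eqP b00; rewrite b00 ltxx in b0.
have gpos : 0 < acos a by apply: acos_gt0; case/andP: a1 => -> _.
exists (2 * pi - acos a); split; first lra.
- by rewrite mulr_natl addrC cosD2pi cosN.
- by rewrite mulr_natl addrC sinD2pi sinN sina ltr0_norm// opprK.
Qed.

Lemma direction_surj y : vdot y y = 1 -> exists t, Theta t /\ direction t = y.
Proof.
case: y => [[a b] c]; rewrite /vdot /= -!expr2 => abc.
have c1 : -1 <= c <= 1.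
  rewrite -ler_norml -(expr_le1 (n := 2))// real_normK ?num_real//.
  by rewrite -abc lerDr addr_ge0 ?sqr_ge0.
have g0 := acos_ge0 c1; have gp := acos_lepi c1; have p0 := pi_gt0 R.
have cosc : cos (acos c) = c by apply: acosK.
have s2 : sin (acos c) ^+ 2 = a ^+ 2 + b ^+ 2 by rewrite sin2cos2 cosc -abc; ring.
set s := sin (acos c) in s2.
have [s0|s0] := eqVneq s 0.
  have [a0 b0] : a = 0 /\ b = 0.
    move: s2; rewrite s0 expr0n /= => /esym/eqP.
    by rewrite paddr_eq0 ?sqr_ge0// !sqrf_eq0 => /andP[/eqP-> /eqP->].
  exists (acos c, 0); rewrite /Theta /direction /= -/s s0 cosc a0 b0 !mul0r; split=> //.
  by split; lra.
have [t [tb ct st]] : exists t, [/\ 0 <= t < 2 * pi, cos t = a / s & sin t = b / s].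
  by apply: circle_angle; rewrite !expr_div_n -mulrDl -s2 divff// expf_neq0.
exists (acos c, t); split; first by rewrite /Theta /=; split=> //; rewrite g0.
by rewrite /direction /= -/s ct st cosc !(mulrC s) !divfK.
Qed.

Lemma anglesP y : vdot y y = 1 -> Theta (angles y) /\ direction (angles y) = y.
Proof. by move=> /direction_surj; rewrite /angles; exact: xgetPex. Qed.

Lemma ev_planar x (rho phi : R) n : x.1.1 = rho * cos phi -> x.1.2 = rho * sin phi ->
  ev x (planar (@X3 R) n).1 = rho ^+ n * cos (n%:R * phi) /\
  ev x (planar (@X3 R) n).2 = rho ^+ n * sin (n%:R * phi).
Proof.
move=> x1 x2; have evN p : ev x (- p) = - ev x p by rewrite /ev !hornerN.
elim: n => [|n [IH1 IH2]].
  rewrite /= !mul0r cos0 sin0 expr0 mulr1 mulr0 -(rmorph0 (@cst3 R)) -(rmorph1 (@cst3 R)).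
  by rewrite !evC.
rewrite planarS /= evD evN !evM evD !evM !evX /coord /= IH1 IH2 x1 x2.
by rewrite -natr1 mulrDl mul1r cosD sinD exprS; split; ring.
Qed.

Lemma ev_axial x (r c : R) l n : (n <= l)%N -> x.2 = r * c -> ev x (r2 (@X3 R)) = r ^+ 2 ->
  ev x (axial (@cst3 R) (@X3 R) l n) = r ^+ (l - n) * (rodrigues R l (l + n)).[c].
Proof.
move=> nl xz xr; set q := rodrigues R l (l + n).
have sz : (size q <= (l - n).+1)%N.
  by have := size_rodrigues R l (l + n); rewrite -addnn subnDl.
have pz i : odd (i + (l - n)) -> q`_i = 0.
  by move=> h; apply: rodrigues_parity; lia.
rewrite /axial /homogenize ev_sum (horner_coef_wide _ sz) mulr_sumr.
rewrite (@sum_parity_le _ (fun i => r ^+ (l - n) * (q`_i * c ^+ i))).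
  apply: eq_bigr => i _; rewrite !evM evC !ev_exp evX /coord /= xz xr exprMn.
  have e : r ^+ (l - n) = r ^+ (l - n - 2 * i) * r ^+ 2 ^+ i.
    by rewrite -exprM -exprD; congr (_ ^+ _); have := ltn_ord i; lia.
  by rewrite e; ring.
by move=> i /pz ->; rewrite mul0r mulr0.
Qed.

Lemma bessel_coef_bounded kappa l : 0 < kappa ->
  exp_bounded (bessel_coef kappa l) (kappa ^+ l) (kappa ^+ 2).
Proof.
move=> k0; split; first by rewrite exprn_ge0// ltW.
split; first exact: sqr_ge0.
move=> j; rewrite /bessel_coef.
have o1 : 1 <= oddfact R (l + j).
  rewrite /oddfact; elim/big_ind: _ => // [u v u1 v1|i _]; first exact: mulr_ege1.
  by rewrite ler1n addn3.
have d1 : 1 <= 2 ^+ j * oddfact R (l + j) :> R by rewrite mulr_ege1// exprn_ege1// ler1n.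
have f0 : 0 < j`!%:R :> R by rewrite ltr0n fact_gt0.
have den : j`!%:R <= 2 ^+ j * j`!%:R * oddfact R (l + j) by rewrite mulrAC ler_peMl// ltW.
rewrite normrM normfV (gtr0_norm (lt_le_trans f0 den)) normrM normrX normrN1 expr1n mul1r.
have k1 : 0 <= kappa ^+ (l + 2 * j) by exact: exprn_ge0 (ltW k0).
rewrite (ger0_norm k1) -exprM -exprD; apply: ler_wpM2l => //.
by rewrite lef_pV2// posrE// (lt_le_trans f0 den).
Qed.

Lemma spherical_besselE kappa l r : 0 < kappa -> 0 < r ->
  spherical_bessel l (kappa * r) = r ^+ l * entire (bessel_coef kappa l) (r ^+ 2).
Proof.
move=> k0 r0; set s := Num.sqrt (pi / (2 * (kappa * r))).
have x0 : 0 < kappa * r by rewrite mulr_gt0.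
have p0 := pi_gt0 R.
have s0 : 0 < s by rewrite sqrtr_gt0 divr_gt0// mulr_gt0.
have s1 : s != 0 by rewrite gt_eqF.
(* The square root in the spherical Bessel function and the half-integer power of kappa r / 2
   combine to sqrt(pi) / 2, which cancels the sqrt(pi) of [Gamma_half]. *)
have sE : s * Num.sqrt (kappa * r / 2) = Num.sqrt pi / 2.
  rewrite /s -sqrtrM ?divr_ge0 ?ltW// ?mulr_gt0//.
  have -> : pi / (2 * (kappa * r)) * (kappa * r / 2) = pi * (2^-1) ^+ 2.
    by field; rewrite !gt_eqF.
  by rewrite sqrtrM ?ltW// sqrtr_sqr ger0_norm.
rewrite /spherical_bessel -/s /besselJ.
have -> : (series (fun k : nat =>
    (-1) ^+ k / (k`!%:R * Gamma (k%:R + (l%:R + 2^-1) + 1)) * (kappa * r / 2) `^ (k%:R *+ 2 + (l%:R + 2^-1))))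
  = (fun N => (r ^+ l / s) * pseries (bessel_coef kappa l) (r ^+ 2) N).
  apply/funext => N; rewrite /pseries /series /= mulr_sumr; apply: eq_bigr => j _.
  have -> : j%:R + (l%:R + 2^-1) + 1 = (l + j)%:R + 2^-1 + 1 :> R by rewrite natrD; ring.
  rewrite Gamma_half.
  have -> : j%:R *+ 2 + (l%:R + 2^-1) = (l + 2 * j)%:R + 2^-1 :> R by rewrite natrD natrM; ring.
  rewrite powRD; last by rewrite gt_eqF ?implybT// divr_gt0.
  rewrite powR_mulrn ?divr_ge0 ?ltW// powR12_sqrt ?divr_ge0 ?ltW//.
  have -> : Num.sqrt (kappa * r / 2) = Num.sqrt pi / 2 / s by apply: (canRL (mulfK s1)); rewrite mulrC.
  have sp : Num.sqrt pi != 0 :> R by rewrite gt_eqF// sqrtr_gt0.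
  have f0 : j`!%:R != 0 :> R by rewrite pnatr_eq0 -lt0n fact_gt0.
  have e (u : R) : u ^+ (l + 2 * j) = u ^+ l * (u ^+ j * u ^+ j) by rewrite exprD mul2n -addnn exprD.
  rewrite /bessel_coef !e expr_div_n !exprMn !exprVn [2 ^+ (l + j).+1]exprS [2 ^+ (l + j)]exprD.
  have o0 := oddfact_neq0 R (l + j).
  have t0 n : 2 ^+ n != 0 :> R by rewrite expf_neq0// pnatr_eq0.
  move: (t0 l) (t0 j) sp f0 o0 s1; move: (2 ^+ l) (2 ^+ j) (Num.sqrt pi) (j`!%:R) (oddfact R (l + j)) s {s0 sE t0} => a b c d f s a0 b0 c0 d0 f0 s0.
  by field; rewrite a0 b0 c0 d0 f0 s0.
have h := exp_bounded_cvg (s := r ^+ 2) (bessel_coef_bounded l k0).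
have -> : limn (fun N => (r ^+ l / s) * pseries (bessel_coef kappa l) (r ^+ 2) N) =
    (r ^+ l / s) * entire (bessel_coef kappa l) (r ^+ 2).
  by apply/cvg_lim => //; apply: cvgMl_tmp.
by rewrite mulrA mulrCA mulfV// mulr1.
Qed.

(** Normalisation of the harmonic, times the factor from order |m| to a negative order m, times the
    constant in Rodrigues' formula. *)
Definition solid_factor l (m : int) : R :=
  let n := absz m in
  harmonic_coef l m * (if m is Negz _ then (-1) ^+ n * ((l - n)`!%:R / (l + n)`!%:R) else 1)
  * ((-1) ^+ n / (2 ^+ l * l`!%:R)).

Definition solid_re l (m : int) : poly3 R :=
  cst3 (solid_factor l m) * ((planar (@X3 R) (absz m)).1 * axial (@cst3 R) (@X3 R) l (absz m)).
(** The sine of m phi is odd in m while [planar] takes |m|, hence the sign for negative m. *)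
Definition solid_im l (m : int) : poly3 R :=
  cst3 ((-1) ^+ (if m is Negz _ then 1 else 0)%N * solid_factor l m)
  * ((planar (@X3 R) (absz m)).2 * axial (@cst3 R) (@X3 R) l (absz m)).

(** Orthonormality in the form that matches [sg_solid_scaled]: it makes 4 pi the ratio of [sg 1] to
    the squared sphere norm of the solid harmonic. *)
Lemma solid_factor_sqr l (m : int) : (absz m <= l)%N ->
  solid_factor l m ^+ 2 * (4 * pi) *
   ((l + absz m)`!%:R / (l - absz m)`!%:R * ((2 ^+ l * l`!%:R) ^+ 2 / l.*2.+1%:R)) = 1.
Proof.
move=> ml; rewrite /solid_factor !exprMn.
have p0 := pi_gt0 R.
have f0 n : n`!%:R != 0 :> R by rewrite pnatr_eq0 -lt0n fact_gt0.
have t0 : 2 ^+ l != 0 :> R by rewrite expf_neq0// pnatr_eq0.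
have fge n : 0 <= n`!%:R :> R by rewrite ler0n.
have d0 : l.*2.+1%:R = 2 * l%:R + 1 :> R by rewrite -natr1 -mul2n natrM.
have d1 : 2 * l%:R + 1 != 0 :> R by rewrite -d0 pnatr_eq0.
rewrite /harmonic_coef sqr_sqrtr; last by rewrite mulr_ge0 ?divr_ge0 ?addr_ge0 ?mulr_ge0 ?(ltW p0).
have p1 : pi != 0 :> R by rewrite gt_eqF.
have s1 n : ((-1) ^+ n) ^+ 2 = 1 :> R by rewrite sqrr_sign.
move: pi p0 p1 => w p0 p1; rewrite d0; case: m ml => n /=; rewrite ?absz_nat => nl.
  have e1 : absz (l%:Z - n%:Z) = (l - n)%N by lia.
  have e2 : absz (l%:Z + n%:Z) = (l + n)%N by lia.
  rewrite ?e1 ?e2.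
  rewrite expr1n exprVn s1.
  have := f0 (l - n)%N; have := f0 (l + n)%N; have := f0 l.
  move: (l`!%:R) ((l + n)`!%:R) ((l - n)`!%:R) (2 ^+ l) t0 => a b c d d0' a0 b0 c0.
  by field; rewrite a0 b0 c0 d0' d1 p1.
have e1 : absz (l%:Z - Negz n) = (l + n.+1)%N by lia.
have e2 : absz (l%:Z + Negz n) = (l - n.+1)%N by lia.
rewrite ?e1 ?e2.
rewrite !exprMn exprVn !s1.
have := f0 (l - n.+1)%N; have := f0 (l + n.+1)%N; have := f0 l.
move: (l`!%:R) ((l + n.+1)`!%:R) ((l - n.+1)`!%:R) (2 ^+ l) t0 => a b c d d0' a0 b0 c0.
by field; rewrite a0 b0 c0 d0' d1 p1.
Qed.

(** j_l(kappa r) is r^l times an entire function of r^2, and the factor r^l turns the spherical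
    harmonic into a polynomial. *)
Lemma spherical_wave_tildeE kappa l (m : int) x : 0 < kappa -> (absz m <= l)%N -> x <> (0, 0, 0) ->
  complex.Re (spherical_wave_tilde kappa l m x)
    = entire (bessel_coef kappa l) (ev x (r2 (@X3 R))) * ev x (solid_re l m) /\
  complex.Im (spherical_wave_tilde kappa l m x)
    = entire (bessel_coef kappa l) (ev x (r2 (@X3 R))) * ev x (solid_im l m).
Proof.
move=> k0 ml xo.
have v0 : 0 <= vdot x x by rewrite /vdot -!expr2 !addr_ge0 ?sqr_ge0.
have xr2 : ev x (r2 (@X3 R)) = vnorm x ^+ 2.
  by rewrite /vnorm sqr_sqrtr// /r2 sum3 !evD !expr2 !evM !evX.
have r0 : 0 < vnorm x.
  rewrite sqrtr_gt0 lt_def v0 andbT; apply: contra_notN xo.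
  case: x {v0 xr2} => [[a b] c]; rewrite /vdot /= -!expr2.
  rewrite !paddr_eq0 ?addr_ge0 ?sqr_ge0// !sqrf_eq0 => /andP[/andP[]].
  by move=> /eqP-> /eqP-> /eqP->.
set r := vnorm x in r0 xr2 *.
have r1 : r != 0 by rewrite gt_eqF.
have [] := @anglesP (vscale r^-1 x).
  have -> : vdot (vscale r^-1 x) (vscale r^-1 x) = (r^-1) ^+ 2 * vdot x x by rewrite /vdot /=; ring.
  by rewrite exprVn -[vdot x x]sqr_sqrtr// -/(vnorm x) -/r mulVf// expf_neq0.
rewrite /spherical_wave_tilde -/r; case: (angles _) => theta phi [/= tb _] dir.
have [x1 x2 x3] : [/\ x.1.1 = r * sin theta * cos phi, x.1.2 = r * sin theta * sin phi & x.2 = r * cos theta].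
  case: dir => d1 d2 d3; rewrite -!mulrA d1 d2 d3 /vscale /=.
  by rewrite !mulVKf.
have [e1 e2] := ev_planar (absz m) x1 x2.
have ea := ev_axial ml x3 xr2.
(* The polar angle lies in [0, pi], so the power n/2 of 1 - cos^2 is sin^n without absolute
   value. *)
have st : 0 <= sin theta by apply: sin_ge0_pi; rewrite ?tb.
rewrite /solid_re /solid_im !evM !evC e1 e2 ea spherical_besselE// xr2.
rewrite /spherical_harmonic.
have leg n : legendre_nat l n (cos theta) = (-1) ^+ n / (2 ^+ l * l`!%:R) * sin theta ^+ n
   * (rodrigues R l (l + n)).[cos theta].
  rewrite /legendre_nat -sin2cos2; congr (_ * _ * _).
  by rewrite mulrC powRrM powR12_sqrt ?sqr_ge0// sqrtr_sqr ger0_norm// powR_mulrn.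
have rl : r ^+ l = r ^+ absz m * r ^+ (l - absz m) by rewrite -exprD subnKC.
rewrite rl /solid_factor exprMn.
case: m ml {rl e1 e2 ea} => n ml; rewrite /legendre leg /=; first by split; ring.
rewrite NegzE mulrNz mulNr cosN sinN.
rewrite -[(n.+1)%:~R]/(n.+1%:R : R); split; ring.
Qed.
End Spherical.

Local Open Scope complex_scope.

(** * Plane waves and the residual *)

Section PlaneWaves.
Variables (R : realType) (kappa : R).
Hypothesis kappa_gt0 : 0 < kappa.
Implicit Types (a b t : R) (x : R * R * R).

(* [a * Re (i ^ n) + b * Im (i ^ n)]: real Taylor coefficients of the plane waves. *)
Definition phase a b n : R :=
  a * ((~~ odd n)%:R * (-1) ^+ n./2) + b * ((odd n)%:R * (-1) ^+ n.-1./2).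

Lemma phaseSS a b n : phase a b n.+2 = - phase a b n.
Proof.
rewrite /phase; have -> : n.+2./2 = n./2.+1 by [].
have -> : odd n.+2 = odd n by rewrite /= negbK.
case: n => [|n]; first by rewrite (_ : odd 0 = false)// !mul0r exprS; ring.
have -> : n.+3.-1./2 = n.+1.-1./2.+1 by [].
by rewrite !exprS; ring.
Qed.

Lemma phase_sqr a b n : phase a b n ^+ 2 + phase (- b) a n ^+ 2 = a ^+ 2 + b ^+ 2.
Proof.
rewrite /phase; case: (odd n); rewrite /= !(mul0r, mul1r, mulr0, addr0, add0r) !exprMn sqrr_sign !mulr1 ?sqrrN //.
by rewrite addrC.
Qed.

Lemma phase_bounded a b : exp_bounded (fun n => phase a b n * (kappa ^+ n / n`!%:R)) (`|a| + `|b|) kappa.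
Proof.
split; first by rewrite addr_ge0.
split=> [|n]; first exact: ltW.
have k0 : 0 <= kappa ^+ n / n`!%:R by rewrite divr_ge0// exprn_ge0// ltW.
rewrite normrM (ger0_norm k0) -mulrA ler_wpM2r// (le_trans (ler_normD _ _))// !normrM !normrX normrN1 !expr1n.
by rewrite lerD// ler_piMr// mulr1; case: (odd n); rewrite /= ?normr1 ?normr0.
Qed.

Lemma entire_phase a b t :
  entire (fun n => phase a b n * (kappa ^+ n / n`!%:R)) t = a * cos (kappa * t) + b * sin (kappa * t).
Proof.
apply/cvg_lim => //.
have -> : pseries (fun n => phase a b n * (kappa ^+ n / n`!%:R)) t =
   (fun N => a * series (cos_coeff (kappa * t)) N + b * series (sin_coeff (kappa * t)) N).
  apply/funext => N; rewrite /pseries /series /= !mulr_sumr -big_split; apply: eq_bigr => n _ /=.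
  by rewrite cos_coeffE sin_coeffE /phase exprMn; ring.
by apply: cvgD; apply: cvgMl_tmp; [rewrite cos.unlock; exact: is_cvg_series_cos_coeff|rewrite sin.unlock; exact: is_cvg_series_sin_coeff].
Qed.

Definition dir (theta : R * R) (i : 'I_3) : R := coord i (direction theta).

Lemma dir1 theta : \sum_i dir theta i ^+ 2 = 1.
Proof.
rewrite sum3 /dir /coord /= !exprMn -mulrDr cos2Dsin2 mulr1 addrC.
exact: cos2Dsin2.
Qed.

Lemma ev_lform theta x : ev x (lform (@cst3 R) (@X3 R) (dir theta)) = vdot (direction theta) x.
Proof. by rewrite /lform sum3 !evD !evM !evC !evX. Qed.

Definition wave3 theta a b N : poly3 R :=
  wave (@cst3 R) (@X3 R) kappa (dir theta) (phase a b) N.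

Lemma approx_wave theta a b (h : nat -> nat) : h @ \oo --> \oo ->
  approx (fun x => a * cos (kappa * vdot (direction theta) x) + b * sin (kappa * vdot (direction theta) x))
         (fun N => wave3 theta a b (h N)).
Proof.
move=> hoo; apply: (approx_subseq hoo).
have := approx_entire (lform (@cst3 R) (@X3 R) (dir theta)) (phase_bounded a b).
by apply: approx_eq => x _; rewrite entire_phase ev_lform.
Qed.

Lemma ReM_cis (z : R[i]) t : complex.Re (z * cis t) = complex.Re z * cos t + (- complex.Im z) * sin t.
Proof. by case: z => a b; rewrite /cis /=; ring. Qed.
Lemma ImM_cis (z : R[i]) t : complex.Im (z * cis t) = complex.Im z * cos t + complex.Re z * sin t.
Proof. by case: z => a b; rewrite /cis /=; ring. Qed.

Lemma Re_sum n (F : 'I_n -> R[i]) : complex.Re (\sum_j F j) = \sum_j complex.Re (F j).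
Proof. by elim/big_rec2: _ => [|j x y _ <-] //=; case: (F j) => ? ?; case: y => ? ?. Qed.
Lemma Im_sum n (F : 'I_n -> R[i]) : complex.Im (\sum_j F j) = \sum_j complex.Im (F j).
Proof. by elim/big_rec2: _ => [|j x y _ <-] //=; case: (F j) => ? ?; case: y => ? ?. Qed.
Lemma ReZ (c : R) (z : R[i]) : complex.Re (c%:C * z) = c * complex.Re z.
Proof. by case: z => a b /=; ring. Qed.
Lemma ImZ (c : R) (z : R[i]) : complex.Im (c%:C * z) = c * complex.Im z.
Proof. by case: z => a b /=; ring. Qed.

Lemma ReB (z w : R[i]) : complex.Re (z - w) = complex.Re z - complex.Re w.
Proof. by case: z => ? ?; case: w. Qed.
Lemma ImB (z w : R[i]) : complex.Im (z - w) = complex.Im z - complex.Im w.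
Proof. by case: z => ? ?; case: w. Qed.

Variables (l : nat) (m : int).
Hypothesis ml : (absz m <= l)%N.

Definition wave_re N := radial (@cst3 R) (@X3 R) (bessel_coef kappa l) N * solid_re R l m.
Definition wave_im N := radial (@cst3 R) (@X3 R) (bessel_coef kappa l) N * solid_im R l m.

Lemma approx_re : approx (fun x => complex.Re (spherical_wave_tilde kappa l m x)) wave_re.
Proof.
have h := approxM (solid_re R l m) (approx_entire (r2 (@X3 R)) (bessel_coef_bounded l kappa_gt0)).
by apply: (approx_eq _ h) => x xo; rewrite (spherical_wave_tildeE kappa_gt0 ml xo).1.
Qed.
Lemma approx_im : approx (fun x => complex.Im (spherical_wave_tilde kappa l m x)) wave_im.
Proof.
have h := approxM (solid_im R l m) (approx_entire (r2 (@X3 R)) (bessel_coef_bounded l kappa_gt0)).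
by apply: (approx_eq _ h) => x xo; rewrite (spherical_wave_tildeE kappa_gt0 ml xo).2.
Qed.

Variables (P : nat) (theta : 'I_P -> R * R) (mu : 'I_P -> R[i]).
Let be := beta kappa l m.
Let c : R := (Num.sqrt P%:R)^-1.

Definition residual_re N : poly3 R := cst3 be * wave_re N +
  \sum_j cst3 (- c) * wave3 (theta j) (complex.Re (mu j)) (- complex.Im (mu j)) (l + 2 * N).
Definition residual_im N : poly3 R := cst3 be * wave_im N +
  \sum_j cst3 (- c) * wave3 (theta j) (complex.Im (mu j)) (complex.Re (mu j)) (l + 2 * N).

Let hoo : (fun N => l + 2 * N)%N @ \oo --> \oo.
Proof.
move=> B [n _ nB]; exists n => // N /= nN; apply: nB => /=.
by rewrite (leq_trans nN)// mul2n -addnn addnA leq_addl.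
Qed.

Let u x := spherical_wave kappa l m x - synthesis kappa theta mu x.

Lemma approx_residual_re : approx (fun x => complex.Re (u x)) residual_re.
Proof.
have h := approxD (approxZ be approx_re) (approx_sum (fun j => approxZ (- c)
   (approx_wave (theta j) (complex.Re (mu j)) (- complex.Im (mu j)) hoo))).
apply: (approx_eq _ h) => x _; rewrite /u /spherical_wave /synthesis ReB !ReZ Re_sum.
congr (_ + _); rewrite mulr_sumr -sumrN; apply: eq_bigr => j _.
by rewrite /plane_wave ReM_cis mulNr.
Qed.
Lemma approx_residual_im : approx (fun x => complex.Im (u x)) residual_im.
Proof.
have h := approxD (approxZ be approx_im) (approx_sum (fun j => approxZ (- c)
   (approx_wave (theta j) (complex.Im (mu j)) (complex.Re (mu j)) hoo))).
apply: (approx_eq _ h) => x _; rewrite /u /spherical_wave /synthesis ImB !ImZ Im_sum.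
congr (_ + _); rewrite mulr_sumr -sumrN; apply: eq_bigr => j _.
by rewrite /plane_wave ImM_cis mulNr.
Qed.

(** Cauchy-Schwarz against the constant 1: the factor P^(-1/2) of the synthesis operator is exactly
    what passing from a sum of moduli to the Euclidean norm costs. *)
Lemma sum_le_sqrt (F : 'I_P -> R) : (0 < P)%N -> (forall j, 0 <= F j) ->
  c * \sum_j Num.sqrt (F j) <= Num.sqrt (\sum_j F j).
Proof.
move=> P0 F0; pose B (f g : 'I_P -> R) := \sum_j f j * g j.
have B_ge0 f : 0 <= B f f by apply: sumr_ge0 => j _; rewrite -expr2 sqr_ge0.
have := @form_cauchy_schwarz R _ B (fun a f g j => a * f j + g j) _ B_ge0 (fun j => Num.sqrt (F j)) (fun=> 1).
move=> /(_ _)/wrap[].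
  move=> a f g; rewrite /B !mulr_sumr -!big_split; apply: eq_bigr => j _ /=; ring.
rewrite /B sumr_const card_ord mulr1.
under eq_bigr do rewrite mulr1; under [X in _ <= X * _ -> _]eq_bigr do rewrite -expr2 sqr_sqrtr//.
move=> h; have sP : 0 < Num.sqrt P%:R :> R by rewrite sqrtr_gt0 ltr0n.
rewrite /c ler_pdivrMl// mulrC -sqrtrM ?sumr_ge0//.
by rewrite -[leLHS]ger0_norm ?sumr_ge0// -sqrtr_sqr; apply: ler_wsqrtr.
Qed.

(** * The estimate for truncations and its limit *)

Local Notation W := (normB kappa (spherical_wave_tilde kappa l m)).
Let K : R := Num.sqrt (l.*2.+1%:R * (4 * pi)).
Local Notation ib := (innerB kappa).

Let normV N := ib (wave_re N) (wave_re N) + ib (wave_im N) (wave_im N).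
Let normD N := ib (residual_re N) (residual_re N) + ib (residual_im N) (residual_im N).

Let k2 : 0 <= kappa ^- 2.
Proof. by rewrite invr_ge0 sqr_ge0. Qed.

Let normV_ge0 N : 0 <= normV N.
Proof. by apply: addr_ge0; apply: (inner_ge0 (@D3 R) (@Iball_ge0 R) k2). Qed.

Lemma residual_bound_partial N : (0 < P)%N ->
  be * normV N - norm_l2 mu * (K * normV N) <= Num.sqrt (normV N) * Num.sqrt (normD N).
Proof.
move=> P0; have c_ge0 : 0 <= c by rewrite invr_ge0 sqrtr_ge0.
pose s := solid_factor R l m; pose e : R := (-1) ^+ (if m is Negz _ then 1 else 0)%N.
have es : (e * s) ^+ 2 = s ^+ 2 by rewrite exprMn sqrr_sign mul1r.
have [h1 _] := harmonic_solid_scaled (@D3D R) (@D3M R) (@D3C R) (@D3X R) k2 ml s.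
have [_ h2] := harmonic_solid_scaled (@D3D R) (@D3M R) (@D3C R) (@D3X R) k2 ml (e * s).
have pE := sg_solid_scaled (@D3D R) (@D3M R) (@D3C R) (@D3X R) (@D3_comm R) (@IballD R) (@IballZ R) (@Iball_parts R) k2 ml es.
have scaled (q a b g z : R) : a * q * b = 1 -> z = a * (g * b) -> q * z = g.
  by move=> ab ->; transitivity (a * q * b * g); [ring|rewrite ab mul1r].
(* The normalisation asked of p = 4 pi: its product with the squared sphere norm of the solid
   harmonic is [sg 1]. *)
have {}pE := scaled _ _ _ _ _ (solid_factor_sqr R ml) pE.
have h := synthesis_bound (@D3D R) (@D3M R) (@D3C R) (@D3X R) (@D3_comm R) (@IballD R) (@IballZ R) (@Iball_ge0 R) (@Iball_parts R)
  kappa k2 N be c_ge0 (fun j => dir1 (theta j)) h1 h2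
  (fun j n => phaseSS (complex.Re (mu j)) (- complex.Im (mu j)) n)
  (fun j n => phaseSS (complex.Im (mu j)) (complex.Re (mu j)) n) pE.
apply: le_trans h.
rewrite -/normV lerD2l lerN2; apply: ler_wpM2r.
  by apply: mulr_ge0; [exact: sqrtr_ge0|exact: (normV_ge0 N)].
(* The two phases are the real and imaginary parts of i^l mu_j, so their squares add up to
   |mu_j|^2. *)
under eq_bigr => j _.
  have -> : phase (complex.Re (mu j)) (- complex.Im (mu j)) l ^+ 2 + phase (complex.Im (mu j)) (complex.Re (mu j)) l ^+ 2 = sqnormc (mu j).
    by have := phase_sqr (complex.Re (mu j)) (- complex.Im (mu j)) l; rewrite opprK sqrrN.
  over.
by apply: sum_le_sqrt => // j; rewrite addr_ge0 ?sqr_ge0.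
Qed.

Lemma cvg_comb (v : nat -> R) w (a b k : R) : v @ \oo --> w ->
  (fun N => a * v N - b * (k * v N)) @ \oo --> a * w - b * (k * w).
Proof. by move=> vw; apply: cvgB; apply: cvgMl_tmp => //; apply: cvgMl_tmp. Qed.

Lemma le_of_cvg (v w : nat -> R) a b : v @ \oo --> a -> w @ \oo --> b ->
  (forall N, v N <= w N) -> a <= b.
Proof. by move=> va wb vw; apply: (ler_cvg_to va wb); exact: nearW. Qed.

Lemma residual_bound : (0 < P)%N ->
  be * W ^+ 2 - norm_l2 mu * (K * W ^+ 2) <= W * normB kappa u.
Proof.
move=> P0.
have cV := normB_cvg (kappa := kappa) approx_re approx_im.
have cD := normB_cvg (kappa := kappa) approx_residual_re approx_residual_im.
have cV2 : normV @ \oo --> W ^+ 2.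
  have -> : normV = (fun N => Num.sqrt (normV N) * Num.sqrt (normV N)).
    by apply/funext => N; rewrite -expr2 sqr_sqrtr.
  rewrite [W ^+ 2]expr2; exact: (cvgM cV cV).
have L : (fun N => be * normV N - norm_l2 mu * (K * normV N)) @ \oo --> be * W ^+ 2 - norm_l2 mu * (K * W ^+ 2).
  exact: cvg_comb cV2.
apply: (le_of_cvg L (cvgM cV cD)) => N; exact: residual_bound_partial.
Qed.

(** Homogeneity of the norm is inherited from the truncations, where the inner product is bilinear,
    by uniqueness of limits. *)
Lemma normB_spherical_wave : normB kappa (spherical_wave kappa l m) = be * W.
Proof.
have be_ge0 : 0 <= be by rewrite invr_ge0 sqrtr_ge0.
have hr : approx (fun x => complex.Re (spherical_wave kappa l m x)) (fun N => cst3 be * wave_re N).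
  by apply: (approx_eq _ (approxZ be approx_re)) => x _; exact: esym (ReZ _ _).
have hi : approx (fun x => complex.Im (spherical_wave kappa l m x)) (fun N => cst3 be * wave_im N).
  by apply: (approx_eq _ (approxZ be approx_im)) => x _; exact: esym (ImZ _ _).
have h2 N : Num.sqrt (ib (cst3 be * wave_re N) (cst3 be * wave_re N) + ib (cst3 be * wave_im N) (cst3 be * wave_im N)) = be * Num.sqrt (normV N).
  rewrite -[be in RHS]ger0_norm// -sqrtr_sqr -sqrtrM ?sqr_ge0//.
  congr (Num.sqrt _); rewrite /normV /innerB.
  rewrite !(innerkl (@D3M R) (@D3C R) (@IballZ R)) !(innerkr (@D3M R) (@D3C R) (@IballZ R)).
  by rewrite !mulrA -expr2 -mulrDr.
have h1 := normB_cvg (kappa := kappa) hr hi.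
rewrite (funext h2) in h1.
have h3 : (fun N => be * Num.sqrt (normV N)) @ \oo --> be * W.
  have := normB_cvg (kappa := kappa) approx_re approx_im.
  exact: cvgMl_tmp.
exact: (cvg_unique (@Rhausdorff R) h1 h3).
Qed.
End PlaneWaves.

Theorem lemma4p4 (R : realType) (kappa : R) (l : nat) (m : int) (eta : R)
    (P : nat) (theta : 'I_P -> R * R) (mu : 'I_P -> R[i])
    (hkappa : 0 < kappa)
    (hm : (absz m <= l)%N)
    (heta : 0 < eta <= 1)
    (hP : (1 <= P)%N)
    (htheta : forall p : 'I_P, Theta (theta p)) :
  normB kappa (fun x => spherical_wave kappa l m x - synthesis kappa theta mu x)
    <= eta * normB kappa (spherical_wave kappa l m) ->
  (1 - eta) * (beta kappa l m / (2 * Num.sqrt (pi * (2 * l%:R + 1))))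
    * normB kappa (spherical_wave kappa l m)
    <= norm_l2 mu.
Proof.
rewrite (normB_spherical_wave hkappa hm) => hu.
have := residual_bound hkappa hm theta mu hP.
have mu0 : 0 <= norm_l2 mu by exact: sqrtr_ge0.
move: hu; set W := normB kappa (spherical_wave_tilde kappa l m).
have -> : beta kappa l m = W^-1 by [].
set U := normB kappa _; move=> hu.
have W0 : 0 <= W by exact: sqrtr_ge0.
have p0 := pi_gt0 R.
set s := Num.sqrt (pi * _).
have s0 : 0 < s by rewrite sqrtr_gt0 mulr_gt0// ltr_wpDl// mulr_ge0.
have KE : Num.sqrt (l.*2.+1%:R * (4 * pi)) = 2 * s :> R.
  have -> : (2 : R) = Num.sqrt (2 ^+ 2) by rewrite sqrtr_sqr ger0_norm.
  rewrite -sqrtrM ?sqr_ge0//; congr Num.sqrt.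
  by rewrite -addn1 -muln2 natrD natrM; ring.
rewrite KE.
(* If [W] is 0 then beta, an inverse of 0, is 0 too, and the left side vanishes. *)
have [W_eq0|Wn0] := eqVneq W 0.
  by move=> _; rewrite W_eq0 invr0 !mul0r mulr0.
have Wp : 0 < W by rewrite lt_def Wn0.
rewrite expr2 mulrA mulVf// mul1r => h.
move: hu; rewrite mulVf// !mulr1 => hu.
(* Since beta W = 1, the hypothesis now reads U <= eta; inserted into the bound on the residual, it
   leaves a common factor [W] to cancel. *)
have h2 : W * (1 - eta) <= W * (norm_l2 mu * (2 * s * W)).
  have : W * U <= W * eta by rewrite ler_pM2l.
  by move: h; nra.
move: h2; rewrite ler_pM2l// => h2.
have Ws : 0 < W * (2 * s) by rewrite !mulr_gt0.
by rewrite -invfM ler_pdivrMr// [W * _]mulrC.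
Qed.
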